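(* Consider the Bastion scheme with blockcipher $BC$ and ciphertexts of $c$ blocks (defined in the context). Consider the following experiment. A key $K$ is sampled once for all, used in the blockcipher, and given to the adversary $\mathcal{A}$, so that she has access to $BC=BC_K$ and $BC^{-1}=BC_K^{-1}$ with this key. Then, on every query of the adversary, a (secret) initialization vector $C_0\in\mathbb{F}_2^{B}$ is sampled uniformly at random and, for all possible pairs $(s,t)$ of distinct indices in $\{0,\dots,c-1\}$ chosen by the adversary, the following is output to her: an index $u$ distinct from $s,t$ is chosen arbitrarily and given to $\mathcal{A}$, and then $\mathcal{A}$ receives the vector of $(\mathbb{F}_2^{B})^{c-2}$ defined by $$\overrightarrow{\mathrm{Pad}_{(s,t,u)}}=\Bigl(BC(C_0+s)+BC(C_0+t)+BC(C_0+u),\ \bigl\{BC(C_0+u)+BC(C_0+i)\bigr\}_{i\in\{0,\dots,c-1\},\ i\notin\{s,t,u\}}\Bigr),$$ where, instead of $BC(C_0+0)$, one should read just $C_0$. If the adversary cannot distinguish this output from a random bit string of the same size, then the security of Bastion is guaranteed, i.e. Bastion satisfies $(c-2)$-CAKE security.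
   Context: A block is an element of $\mathbb{F}_2^{B}$, with $B$ the security parameter; $+$ on blocks is XOR, and adding an integer $i$ to a block means adding the binary writing of $i$ seen as a vector of $\mathbb{F}_2^{B}$. $BC$ is a keyed blockcipher: for each key $K$, $BC_K$ is a permutation of $\mathbb{F}_2^{B}$. **Bastion scheme.** On input a key $K$ and a plaintext $P=(P_1,\dots,P_{c-1})$ of $c-1$ blocks: sample an initialization vector $C_0\in\mathbb{F}_2^{B}$ uniformly at random and set $C_i=P_i+BC_K(C_0+i)$ for $1\le i\le c-1$ (counter mode), giving the ciphertext $C=(C_0,\dots,C_{c-1})$; output the transformed ciphertext $C'=C\cdot Mat$, where $Mat$ is the $c\times c$ binary matrix with all diagonal entries $0$ and all off-diagonal entries $1$, i.e. $C'_j=\sum_{i\ne j}C_i$ for $0\le j\le c-1$. **$(c-2)$-CAKE security** (Ciphertext Access under Key Exposure): indistinguishability under chosen plaintexts against an adversary able to access any $c-2$ blocks of the transformed ciphertext as well as the encryption key. That is, every polynomial adversary has negligible advantage in the following game: the key $K$ is sampled at random and given to the adversary, who may evaluate $BC_K$, $BC_K^{-1}$ and the scheme on inputs of her choice; she outputs two plaintexts $P^{0},P^{1}$ of the same length; a random bit $b$ is chosen and the transformed ciphertext $C'$ of $P^{b}$ is computed; the adversary chooses $c-2$ block positions and receives the corresponding blocks of $C'$; she outputs a bit $b'$ and wins if $b'=b$. ''Cannot distinguish'' and ''negligible advantage'' are for polynomial adversaries, with respect to $B$: if $M$ is the number of queries of the adversary, a negligible function is a fixed polynomial in $B$, $c$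 and $M$, divided by $2^{B}$, and negligible advantage means winning with probability $1/2$ plus or minus a negligible function.
   Formalization: For odd c the claim can fail (c=3, BC(x+3)=BC(x)+d: the pad is uniform but C'_0=P_1+P_2+d); it is proved for c with Mat invertible (c even), and for every c if the Pad output is indistinguishable for all polynomially bounded block counts. *)

(* Defs.v *)
From HB Require Import structures.
From mathcomp Require Import all_boot all_order all_algebra all_fingroup.
From mathcomp Require Import mpoly.

Set Implicit Arguments.
Unset Strict Implicit.
Unset Printing Implicit Defensive.

Import GRing.Theory Num.Theory.
Local Open Scope ring_scope.

(* * Finite random experiments *)

(* [Draw k] draws an element of the finite type [T] uniformly and independently
   of the past; all the types drawn from below are inhabited. *)
Inductive exper (A : Type) : Type :=
| Ret of A
| Draw (T : finType) of (T -> exper A).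

Arguments Ret {A} _.
Arguments Draw {A T} _.

Fixpoint bind (A A' : Type) (e : exper A) (k : A -> exper A') : exper A' :=
  match e with
  | Ret a => k a
  | Draw T f => Draw (fun x : T => bind (f x) k)
  end.

Declare Scope exper_scope.
Local Open Scope exper_scope.
Notation "x <~ e ;; k" := (bind e (fun x => k))
  (at level 100, e at next level, right associativity) : exper_scope.
Notation "x <$ T ;; k" := (Draw (fun x : T => k))
  (at level 100, T at next level, right associativity) : exper_scope.

Fixpoint Pr (e : exper bool) : rat :=
  match e with
  | Ret b => b%:R
  | Draw T f => (\sum_(x : T) Pr (f x)) / #|T|%:R
  end.

(* * Polynomial adversaries

   An adversary is a probabilistic oracle circuit over F_2, written as a
   straight-line program over one-bit registers indexed by nat. A family of
   such programs whose sizes are polynomial in the security parameter is a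
   (non-uniform) polynomial adversary. *)

Inductive instr (O : Type) : Type :=
| One of nat                          (* r_d := 1 *)
| Add of nat & nat & nat              (* r_d := r_a + r_b *)
| Mul of nat & nat & nat              (* r_d := r_a * r_b *)
| Coin of nat                         (* r_d := uniform bit *)
| Call of O & nat & nat.              (* oracle, input address, output address *)

Definition prog (O : Type) := seq (instr O).

Definition is_call (O : Type) (i : instr O) : bool :=
  if i is Call _ _ _ then true else false.

Definition queries (O : Type) (p : prog O) : nat := count (@is_call O) p.

Definition registers := nat -> 'F_2.

Definition store (m : registers) (d : nat) (s : seq 'F_2) : registers :=
  fun a => if (d <= a < d + size s)%N then s`_(a - d) else m a.

(* An oracle sees its input as the sequence of registers from the input address
   on (it only reads the finite prefix encoding its argument), and its answer
   is written from the output address on. *)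
Definition oracles (O : Type) := O -> registers -> exper (seq 'F_2).

Definition step (O : Type) (ans : oracles O) (i : instr O) (m : registers) :
    exper registers :=
  match i with
  | One d => Ret (store m d [:: 1])
  | Add d a b => Ret (store m d [:: m a + m b])
  | Mul d a b => Ret (store m d [:: m a * m b])
  | Coin d => x <$ 'F_2 ;; Ret (store m d [:: x])
  | Call o src dst =>
      y <~ ans o (fun a => m (src + a)%N) ;; Ret (store m dst y)
  end.

Fixpoint run (O : Type) (ans : oracles O) (p : prog O) (m : registers) : exper registers :=
  if p is i :: p' then m' <~ step ans i m ;; run ans p' m' else Ret m.

(* * Blocks *)

Definition block (B : nat) := 'cV['F_2]_B.

(* The binary writing of i, least significant bit first; it is faithful when
   i < 2 ^ B, and bits of higher weight are dropped otherwise. *)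
Definition bin (B i : nat) : block B := \col_(r < B) (odd (i %/ 2 ^ r))%:R.

Definition bits (n : nat) (w : 'cV['F_2]_n) : seq 'F_2 :=
  [seq w r 0 | r <- enum 'I_n].

Definition bits_of_blocks (B : nat) (s : seq (block B)) : seq 'F_2 :=
  flatten [seq bits w | w <- s].

Definition read_block (B : nat) (m : registers) (a : nat) : block B :=
  \col_(r < B) m (a + r)%N.

Definition read_blocks (B n : nat) (m : registers) (a : nat) : n.-tuple (block B) :=
  [tuple read_block B m (a + i * B)%N | i < n].

(* An index i < c is communicated as the i-th unit vector of F_2^c. *)
Definition read_index (c : nat) (m : registers) (a : nat) : option 'I_c :=
  [pick i : 'I_c | read_block c m a == delta_mx i 0].

Definition bits_of_index (c : nat) (i : 'I_c) : seq 'F_2 :=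
  bits (delta_mx i 0 : 'cV['F_2]_c).

(* * The Bastion scheme *)

Record blockcipher := Blockcipher {
  keylen : nat -> nat;
  cipher : forall B : nat, 'cV['F_2]_(keylen B) -> {perm block B}
}.

(* [ctr E C0 i] is E (C0 + i), to be read as C0 itself for i = 0. *)
Definition ctr (B : nat) (E : {perm block B}) (C0 : block B) (i : nat) :
    block B :=
  if i == 0 then C0 else E (C0 + bin B i).

Definition bastion_mx (c : nat) : 'M['F_2]_c := \matrix_(i, j) (i != j)%:R.

(* The plaintext (P_1, ..., P_(c-1)) is a tuple, so P_i has rank i.-1; the
   ciphertext block C_i is column i. *)
Definition ctr_ciphertext (B c : nat) (E : {perm block B}) (C0 : block B)
    (P : c.-1.-tuple (block B)) : 'M['F_2]_(B, c) :=
  \matrix_(r, i) (if i == 0%N :> nat then C0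
                  else P`_i.-1 + E (C0 + bin B i)) r 0.

Definition bastion (B c : nat) (E : {perm block B})
    (P : c.-1.-tuple (block B)) : exper 'M['F_2]_(B, c) :=
  C0 <$ block B ;; Ret (ctr_ciphertext E C0 P *m bastion_mx c).

(* * Polynomials and negligible functions *)

(* Advantage of a winning probability, against a polynomial in B, c and M
   divided by 2 ^ B. *)
Definition advantage_le (p : {mpoly rat[3]}) (B c M : nat) (e : exper bool) :
    bool :=
  `| Pr e - 1 / 2%:R | <= p.@[fun k => (nth 0%N [:: B; c; M] k)%:R] / 2%:R ^+ B.

(* Numbers of blocks, possibly growing polynomially with B. *)
Definition block_count (c : nat -> nat) : Prop :=
  (forall B, (2 < c B)%N) /\
  exists t : {poly nat}, forall B, (c B <= t.[B])%N.

(* * (c-2)-CAKE security *)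

Inductive cake_oracle := EvalBC | EvalBCinv | EvalBastion.

Definition cake_oracles (B c : nat) (E : {perm block B}) :
    oracles cake_oracle :=
  fun o m => match o with
  | EvalBC => Ret (bits (E (read_block B m 0)))
  | EvalBCinv => Ret (bits ((E^-1)%g (read_block B m 0)))
  | EvalBastion =>
      C' <~ bastion E (read_blocks B c.-1 m 0) ;;
      Ret (bits_of_blocks [seq col j C' | j <- enum 'I_c])
  end.

(* The three stages share their registers. [adv_find] leaves P^0 then P^1 from
   register 0 on; [adv_choose] leaves in registers 0..c-1 the indicator vector of
   the positions; [adv_guess] finds the corresponding blocks from register 0 on and
   leaves b' in register 0. *)
Record cake_adversary := CakeAdversary {
  adv_find : prog cake_oracle;
  adv_choose : prog cake_oracle;
  adv_guess : prog cake_oracle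
}.

Definition cake_size (A : cake_adversary) : nat :=
  (size (adv_find A) + size (adv_choose A) + size (adv_guess A))%N.

Definition cake_queries (A : cake_adversary) : nat :=
  (queries (adv_find A) + queries (adv_choose A) + queries (adv_guess A))%N.

Section CakeGame.
Variables (BC : blockcipher) (B c : nat).

(* Nothing is revealed unless exactly c - 2 positions are chosen. *)
Definition reveal (C' : 'M['F_2]_(B, c)) (S : {set 'I_c}) (m : registers) : registers :=
  if #|S| == (c - 2)%N then
    store m 0 (bits_of_blocks [seq col j C' | j <- enum 'I_c & j \in S])
  else m.

Definition cake_game (A : cake_adversary) : exper bool :=
  K <$ 'cV['F_2]_(keylen BC B) ;;
  let E := cipher K in
  m1 <~ run (cake_oracles c E) (adv_find A) (store (fun=> 0) 0 (bits K)) ;;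
  let P0 := read_blocks B c.-1 m1 0 in
  let P1 := read_blocks B c.-1 m1 (c.-1 * B)%N in
  b <$ bool ;;
  C' <~ bastion E (if b then P1 else P0) ;;
  m2 <~ run (cake_oracles c E) (adv_choose A) m1 ;;
  let S := [set i : 'I_c | m2 i == 1] in
  m3 <~ run (cake_oracles c E) (adv_guess A) (reveal C' S m2) ;;
  Ret ((m3 0%N == 1) == b).

End CakeGame.

Definition cake_secure (BC : blockcipher) (c : nat -> nat) : Prop :=
  forall t : {poly nat}, exists p : {mpoly rat[3]},
  forall (B : nat) (A : cake_adversary), (cake_size A <= t.[B])%N ->
    advantage_le p B (c B) (cake_queries A) (cake_game BC B (c B) A).

(* * Indistinguishability of Pad *)

Definition pad (B c : nat) (E : {perm block B}) (C0 : block B)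
    (s t u : 'I_c) : seq (block B) :=
  (ctr E C0 s + ctr E C0 t + ctr E C0 u)
    :: [seq ctr E C0 u + ctr E C0 (i : 'I_c)
       | i <- [seq i <- enum 'I_c | i \notin [:: s; t; u]]].

(* A rule by which the index u is chosen from s and t. *)
Definition index_rule := forall B c : nat, 'I_c -> 'I_c -> 'I_c.

Definition index_rule_ok (sel : index_rule) : Prop :=
  forall (B c : nat) (s t : 'I_c), (2 < c)%N -> s != t ->
    sel B c s t != s /\ sel B c s t != t.

Inductive pad_oracle := PadBC | PadBCinv | PadQuery.

(* A query reads s then t; it is left unanswered if they are not two distinct
   indices. *)
Definition pad_oracles (sel : index_rule) (B c : nat) (E : {perm block B})
    (real : bool) : oracles pad_oracle :=
  fun o m => match o with
  | PadBC => Ret (bits (E (read_block B m 0)))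
  | PadBCinv => Ret (bits ((E^-1)%g (read_block B m 0)))
  | PadQuery =>
      if (read_index c m 0, read_index c m c) is (Some s, Some t) then
        if s == t then Ret [::] else
        let u := sel B c s t in
        if real then
          C0 <$ block B ;;
          Ret (bits_of_index u ++ bits_of_blocks (pad E C0 s t u))
        else
          R <$ ((c - 2).-tuple (block B)) ;;
          Ret (bits_of_index u ++ bits_of_blocks R)
      else Ret [::]
  end.

Definition pad_game (BC : blockcipher) (sel : index_rule) (B c : nat)
    (A : prog pad_oracle) : exper bool :=
  K <$ 'cV['F_2]_(keylen BC B) ;;
  real <$ bool ;;
  m <~ run (pad_oracles sel c (cipher K) real) A (store (fun=> 0) 0 (bits K)) ;;
  Ret ((m 0%N == 1) == real).

Definition pad_indistinguishable (BC : blockcipher) (sel : index_rule)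
    (c : nat -> nat) : Prop :=
  forall t : {poly nat}, exists p : {mpoly rat[3]},
  forall (B : nat) (A : prog pad_oracle), (size A <= t.[B])%N ->
    advantage_le p B (c B) (queries A) (pad_game BC sel B (c B) A).

(* Main.v *)
(* A pad on c2 blocks with holes s, t determines every sum of
   a (x_s + x_t) and of blocks other than x_s, x_t whose number has the parity
   of a, where x_i is the i-th counter block. When c is even, the blocks of the
   transformed ciphertext other than s and t are such sums for c2 = c, plus
   sums of plaintext blocks. When c is odd they are sums of an even number of
   the c blocks, so one takes c2 = c + 2 and the two extra blocks as holes.
   The plaintext part of the revealed blocks is itself a translation of the
   pad, hence a uniform pad hides it.

   Adversaries are non-uniform, so for each set of c - 2 positions S0 and each
   bit b one may hardwire S0 and b in a pad adversary: it runs the CAKE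
   adversary on P^b, answering encryption queries with the blockcipher oracle,
   builds the revealed blocks from one pad query, and outputs 1 when the
   positions chosen were S0 and the guess is 1. Summing over the at most c^2
   sets S0 multiplies the advantage by a polynomial. *)
Require Import Defs.
From mathcomp Require Import all_boot all_order all_algebra all_fingroup.
From mathcomp Require Import mpoly.
From mathcomp Require Import zify ring.
From Stdlib Require Import FunctionalExtensionality.
Local Open Scope ring_scope.

Set Implicit Arguments.
Unset Strict Implicit.
Unset Printing Implicit Defensive.

Import Order.TTheory GRing.Theory Num.Theory.

(** * Expectations *)

Fixpoint Ex (A : Type) (e : exper A) (f : A -> rat) : rat :=
  match e with
  | Ret a => f a
  | Draw T k => (\sum_(x : T) Ex (k x) f) / #|T|%:R
  end.

Lemma PrE (e : exper bool) : Pr e = Ex e (fun b => b%:R).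
Proof. by elim: e => //= T k IH; congr (_ * _); apply: eq_bigr. Qed.

Lemma Ex_bind (A A' : Type) (e : exper A) (k : A -> exper A') (f : A' -> rat) :
  Ex (bind e k) f = Ex e (fun a => Ex (k a) f).
Proof. by elim: e => //= T g IH; under eq_bigr do rewrite IH. Qed.

Lemma eq_Ex (A : Type) (e : exper A) (f g : A -> rat) :
  f =1 g -> Ex e f = Ex e g.
Proof. by move=> fg; elim: e => //= T k IH; congr (_ * _); apply: eq_bigr. Qed.

Lemma eq_Ex_Draw (A A' : Type) (T : finType) (k : T -> exper A)
    (k' : T -> exper A') (f : A -> rat) (f' : A' -> rat) :
  (forall x, Ex (k x) f = Ex (k' x) f') -> Ex (Draw k) f = Ex (Draw k') f'.
Proof. by move=> kk /=; congr (_ * _); apply: eq_bigr. Qed.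

Lemma Ex_sum (A : Type) (e : exper A) (I : finType) (P : pred I)
    (F : I -> A -> rat) :
  Ex e (fun a => \sum_(i | P i) F i a) = \sum_(i | P i) Ex e (F i).
Proof.
elim: e => //= T k IH; rewrite -mulr_suml exchange_big /=.
by congr (_ * _); apply: eq_bigr.
Qed.

Lemma Ex_mulr (A : Type) (e : exper A) (f : A -> rat) (r : rat) :
  Ex e (fun a => f a * r) = Ex e f * r.
Proof.
elim: e => //= T k IH; rewrite [RHS]mulrAC [X in _ = X / _]mulr_suml.
by congr (_ * _); apply: eq_bigr.
Qed.

Lemma ExD (A : Type) (e : exper A) (f g : A -> rat) :
  Ex e (fun a => f a + g a) = Ex e f + Ex e g.
Proof.
elim: e => //= T k IH; rewrite -mulrDl -big_split.
by congr (_ * _); apply: eq_bigr.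
Qed.

Lemma ExB (A : Type) (e : exper A) (f g : A -> rat) :
  Ex e (fun a => f a - g a) = Ex e f - Ex e g.
Proof.
elim: e => //= T k IH; rewrite -mulrBl -sumrB.
by congr (_ * _); apply: eq_bigr.
Qed.

(** * Experiments of total mass one, and couplings *)

Definition lossless (A : Type) (e : exper A) : Prop :=
  forall r, Ex e (fun=> r) = r.

Lemma lossless_bind (A A' : Type) (e : exper A) (k : A -> exper A') :
  lossless e -> (forall a, lossless (k a)) -> lossless (bind e k).
Proof. by move=> le lk r; rewrite Ex_bind (eq_Ex _ (fun a => lk a r)). Qed.

(** The witness [x] excludes an empty [T], for which the sum is empty and the mass is 0. *)
Lemma lossless_Draw (A : Type) (T : finType) (x : T) (k : T -> exper A) :
  (forall y, lossless (k y)) -> lossless (Draw k).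
Proof.
move=> lk r; rewrite /= (eq_bigr (fun=> r)) => [|y _]; last exact: lk.
rewrite sumr_const -[r *+ _]mulr_natr mulfK // pnatr_eq0 -lt0n.
by apply/card_gt0P; exists x.
Qed.

Lemma lossless_run (O : Type) (ans : oracles O) (p : prog O) (m : registers) :
  (forall o m', lossless (ans o m')) -> lossless (run ans p m).
Proof.
move=> lans; elim: p m => //= i p IH m; apply: lossless_bind => // {p IH}.
case: i => //= [d|o s d]; first exact: (lossless_Draw (0 : 'F_2)).
by apply: lossless_bind.
Qed.

(** Dual form of a probabilistic coupling supported on [R]: stated on test functions, it requires no
    joint distribution. *)
Definition coupled (A A' : Type) (R : A -> A' -> Prop) (e : exper A)
    (e' : exper A') : Prop :=
  forall f g, (forall a a', R a a' -> f a = g a') -> Ex e f = Ex e' g.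

Lemma coupled_bind (A A' C C' : Type) (R : A -> A' -> Prop) (Q : C -> C' -> Prop)
    (e : exper A) (e' : exper A') (k : A -> exper C) (k' : A' -> exper C') :
  coupled R e e' -> (forall a a', R a a' -> coupled Q (k a) (k' a')) ->
  coupled Q (bind e k) (bind e' k').
Proof.
move=> Re Rk f g fg; rewrite !Ex_bind; apply: Re => a a' Raa'.
exact: Rk fg.
Qed.

Lemma coupled_Draw (A A' : Type) (R : A -> A' -> Prop) (T : finType)
    (k : T -> exper A) (k' : T -> exper A') :
  (forall x, coupled R (k x) (k' x)) -> coupled R (Draw k) (Draw k').
Proof.
by move=> Rk f g fg /=; congr (_ * _); apply: eq_bigr => x _; apply: Rk.
Qed.

Lemma bindA (A C D : Type) (e : exper A) (k : A -> exper C) (l : C -> exper D) :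
  bind (bind e k) l = bind e (fun a => bind (k a) l).
Proof.
by elim: e => //= T g IH; congr Draw; apply: functional_extensionality.
Qed.

Lemma bind_Ret (A : Type) (e : exper A) : bind e Ret = e.
Proof.
by elim: e => //= T g IH; congr Draw; apply: functional_extensionality.
Qed.

Lemma run_cat (O : Type) (ans : oracles O) (p q : prog O) (m : registers) :
  run ans (p ++ q) m = bind (run ans p m) (run ans q).
Proof.
elim: p m => //= i p IH m; rewrite bindA; congr bind.
exact: functional_extensionality.
Qed.

Lemma run_call (O : Type) (ans : oracles O) (o : O) (s d : nat) (m : registers) :
  run ans [:: Call o s d] m
    = bind (ans o (fun a => m (s + a)%N)) (fun y => Ret (store m d y)).
Proof. exact: bind_Ret. Qed.

(** * Straight-line programs for linear maps *)

Lemma F2_addxx (x : 'F_2) : x + x = 0.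
Proof. by case: x => [[|[|]]] //= ?; apply: val_inj. Qed.

Lemma F2_cases (x : 'F_2) : x = (x == 1)%:R.
Proof. by case: x => [[|[|]]] //= ?; apply: val_inj. Qed.

Lemma store1E (m : registers) (d : nat) (v : 'F_2) (a : nat) :
  store m d [:: v] a = if a == d then v else m a.
Proof.
rewrite /store /= addn1 ltnS -eqn_leq eq_sym.
by case: eqP => // ->; rewrite subnn.
Qed.

Lemma store_out (m : registers) (d : nat) (s : seq 'F_2) (a : nat) :
  (a < d)%N || (d + size s <= a)%N -> store m d s a = m a.
Proof. by rewrite /store => h; case: ifP => // h'; lia. Qed.

Lemma store_in (m : registers) (d : nat) (s : seq 'F_2) (k : nat) :
  (k < size s)%N -> store m d s (d + k)%N = s`_k.
Proof.
by move=> h; rewrite /store leq_addr ltn_add2l h addKn.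
Qed.

Section Assign.
Variable O : Type.

(** No instruction writes 0; in characteristic 2, adding [d] to itself clears it. *)
Definition lincomb (d : nat) (s : seq nat) : prog O :=
  Add _ d d d :: [seq Add _ d d x | x <- s].

Lemma run_lincomb (ans : oracles O) (d : nat) (s : seq nat) (m : registers) :
  d \notin s ->
  run ans (lincomb d s) m = Ret (store m d [:: \sum_(x <- s) m x]).
Proof.
rewrite /lincomb /= F2_addxx => ds.
suff acc v : run ans [seq Add _ d d x | x <- s] (store m d [:: v])
    = Ret (store m d [:: v + \sum_(x <- s) m x]) by rewrite acc add0r.
elim: s ds v => [|x s IH] /=; first by rewrite big_nil => _ v; rewrite addr0.
rewrite inE negb_or => /andP[dx ds] v; rewrite big_cons addrA -IH //.
congr run; apply: functional_extensionality => a.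
rewrite !store1E eqxx [x == d]eq_sym (negbTE dx); by case: eqP.
Qed.

Definition assign_sums (D n : nat) (S : nat -> seq nat) : prog O :=
  flatten [seq lincomb (D + k) (S k) | k <- iota 0 n].

(** The sources avoid the whole target window, so no assignment disturbs a later one and all sums
    refer to the initial memory. *)
Lemma run_assign_sums (ans : oracles O) (D n : nat) (S : nat -> seq nat)
    (m : registers) :
  (forall k x, (k < n)%N -> x \in S k -> (x < D)%N || (D + n <= x)%N) ->
  run ans (assign_sums D n S) m
    = Ret (store m D (mkseq (fun k => \sum_(x <- S k) m x) n)).
Proof.
rewrite /assign_sums; elim: n => [|n IH] hS.
  congr Ret; apply: functional_extensionality => a.
  by rewrite store_out //= addn0; lia.
rewrite -addn1 iotaD map_cat flatten_cat /= cats0 add0n run_cat IH => [|k x kn xk].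
  rewrite /= -/(lincomb _ _) /=.
  have := @run_lincomb ans (D + n)%N (S n).
  rewrite /lincomb /= => ->; last first.
    by apply/negP => xS; have := hS n _ (ltnSn n) xS; lia.
  congr Ret; apply: functional_extensionality => a.
  rewrite store1E /store !size_mkseq.
  case: (eqVneq a (D + n)%N) => [->|ne].
    rewrite ifT; last lia; rewrite addKn nth_mkseq ?addn1 //=.
    apply: eq_big_seq => x xS; have h := hS n x (ltnSn n) xS.
    by rewrite ifF //; lia.
  have -> : (D <= a < D + (n + 1))%N = (D <= a < D + n)%N by lia.
  by case: (boolP (D <= a < D + n)%N) => // h; rewrite !nth_mkseq //; lia.
by have := hS k x _ xk; lia.
Qed.

Lemma size_assign_sums (D n q : nat) (S : nat -> seq nat) :
  (forall k, (k < n)%N -> (size (S k) <= q)%N) ->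
  (size (assign_sums D n S) <= n * q.+1)%N.
Proof.
rewrite /assign_sums; elim: n => // n IH hS.
rewrite -addn1 iotaD map_cat flatten_cat /= cats0 size_cat /= size_map add0n.
rewrite addn1 mulSn addnC leq_add //; first by rewrite ltnS hS.
by apply: IH => k kn; apply: hS; lia.
Qed.

Lemma queries_assign_sums (D n : nat) (S : nat -> seq nat) :
  queries (assign_sums D n S) = 0%N.
Proof.
rewrite /queries /assign_sums; elim: (iota 0 n) => //= k s IH.
rewrite count_cat IH addn0 /= add0n count_map.
by elim: (S k).
Qed.

Definition coins (D n : nat) : prog O := [seq Coin _ (D + k) | k <- iota 0 n].

End Assign.

(** * Bits of blocks *)

(** Indexed by [nat], with value 0 from [n] on, to match register addresses without ordinals. *)
Definition bit (n : nat) (w : 'cV['F_2]_n) (r : nat) : 'F_2 := (bits w)`_r.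

Lemma size_bits (n : nat) (w : 'cV['F_2]_n) : size (bits w) = n.
Proof. by rewrite size_map size_enum_ord. Qed.

Lemma bit_ord (n : nat) (w : 'cV['F_2]_n) (i : 'I_n) : bit w i = w i 0.
Proof.
by rewrite /bit /bits (nth_map i) ?size_enum_ord // nth_ord_enum.
Qed.

Lemma bitP (n : nat) (v w : 'cV['F_2]_n) :
  (forall r, (r < n)%N -> bit v r = bit w r) -> v = w.
Proof.
by move=> vw; apply/colP => i; rewrite -!bit_ord; apply: vw.
Qed.

Lemma bitE (n : nat) (f : 'I_n -> 'F_2) (r : nat) (rn : (r < n)%N) :
  bit (\col_i f i) r = f (Ordinal rn).
Proof. by rewrite -[r]/(val (Ordinal rn)) bit_ord mxE. Qed.

Lemma bit_out (n : nat) (w : 'cV['F_2]_n) (r : nat) : (n <= r)%N -> bit w r = 0.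
Proof. by move=> nr; rewrite /bit nth_default // size_bits. Qed.

Lemma bit_sum (n : nat) (I : Type) (s : seq I) (P : pred I)
    (F : I -> 'cV['F_2]_n) (r : nat) :
  bit (\sum_(i <- s | P i) F i) r = \sum_(i <- s | P i) bit (F i) r.
Proof.
have [rn|nr] := ltnP r n; last by rewrite bit_out // big1 // => *; rewrite bit_out.
rewrite -[r]/(val (Ordinal rn)) bit_ord summxE.
by apply: eq_bigr => i _; rewrite bit_ord.
Qed.

Lemma bitD (n : nat) (v w : 'cV['F_2]_n) (r : nat) :
  bit (v + w) r = bit v r + bit w r.
Proof.
have [rn|nr] := ltnP r n; last by rewrite !bit_out ?addr0.
by rewrite -[r]/(val (Ordinal rn)) !bit_ord mxE.
Qed.

Lemma bit0 (n r : nat) : bit (0 : 'cV['F_2]_n) r = 0.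
Proof.
have [rn|nr] := ltnP r n; last by rewrite bit_out.
by rewrite -[r]/(val (Ordinal rn)) bit_ord mxE.
Qed.

Lemma bit_read (B : nat) (m : registers) (a r : nat) :
  (r < B)%N -> bit (read_block B m a) r = m (a + r)%N.
Proof. by move=> rB; rewrite bitE. Qed.

Lemma size_bits_of_blocks (B : nat) (s : seq (block B)) :
  size (bits_of_blocks s) = (size s * B)%N.
Proof.
elim: s => //= w s IH; rewrite size_cat size_bits.
by move: IH; rewrite /bits_of_blocks => ->; rewrite mulSn.
Qed.

Lemma nth_bits_of_blocks (B : nat) (s : seq (block B)) (i r : nat) :
  (r < B)%N -> (bits_of_blocks s)`_(i * B + r) = bit s`_i r.
Proof.
move=> rB; elim: s i => [|w s IH] [|i] /=; rewrite ?nth_nil ?bit0 //.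
  by rewrite /bits_of_blocks /= nth_cat size_bits mul0n add0n rB.
rewrite /bits_of_blocks /= nth_cat size_bits mulSn -addnA ltnNge leq_addr /=.
by rewrite addKn IH.
Qed.

Lemma ltn_block (i c r B : nat) : (i < c)%N -> (r < B)%N -> (i * B + r < c * B)%N.
Proof. nia. Qed.

Lemma block_divmod (c B k : nat) : (k < c * B)%N ->
  [/\ (k %/ B < c)%N, (k %% B < B)%N & k = (k %/ B * B + k %% B)%N].
Proof.
move=> kcB; have B0 : (0 < B)%N by case: B kcB => //; rewrite muln0.
by rewrite ltn_divLR // ltn_pmod // -divn_eq.
Qed.

Lemma bits_of_blocks_mkseq (B n : nat) (s : seq (block B)) (f : nat -> 'F_2) :
  size s = n ->
  (forall i r, (i < n)%N -> (r < B)%N -> bit s`_i r = f (i * B + r)%N) ->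
  bits_of_blocks s = mkseq f (n * B).
Proof.
move=> sn h; apply: (@eq_from_nth _ 0).
  by rewrite size_bits_of_blocks size_mkseq sn.
move=> k; rewrite size_bits_of_blocks sn => kn; rewrite nth_mkseq //.
by have [h1 h2 ->] := block_divmod kn; rewrite nth_bits_of_blocks // h.
Qed.

(** * Uniform vectors from independent coins *)

Lemma sum_colS (n : nat) (F : 'cV['F_2]_n.+1 -> rat) :
  \sum_w F w = \sum_(x : 'F_2) \sum_(w : 'cV_n) F (col_mx (x%:M : 'cV_1) w).
Proof.
rewrite pair_big /= (reindex (fun p => col_mx (p.1%:M : 'cV_1) p.2)) //=.
exists (fun w : 'cV_(1 + n) => (usubmx w 0 0, dsubmx w)) => [[x w]|w] _ /=.
  by rewrite col_mxKu col_mxKd mxE eqxx.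
by rewrite -mx11_scalar vsubmxK.
Qed.

Lemma bits_colS (n : nat) (x : 'F_2) (w : 'cV['F_2]_n) :
  bits (col_mx (x%:M : 'cV_1) w : 'cV_n.+1) = x :: bits w.
Proof.
rewrite /bits enum_ordSl /= -map_comp; congr (_ :: _).
  transitivity (col_mx (x%:M : 'cV_1) w (lshift n 0) 0); last first.
    by rewrite col_mxEu mxE eqxx.
  by congr (fun_of_matrix _ _ _); apply: val_inj.
apply: eq_map => i /=.
transitivity (col_mx (x%:M : 'cV_1) w (rshift 1 i) 0); last by rewrite col_mxEd.
by congr (fun_of_matrix _ _ _); apply: val_inj.
Qed.

(** By [sum_colS], a uniform vector is a uniform bit followed by a shorter uniform vector. A
    program, which has only coins, samples its initialization vectors in this way. *)
Lemma Ex_coins (O : Type) (ans : oracles O) (D n : nat) (m : registers)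
    (f : registers -> rat) :
  Ex (run ans (coins O D n) m) f
    = (\sum_(w : 'cV['F_2]_n) f (store m D (bits w))) / #|{: 'cV['F_2]_n}|%:R.
Proof.
rewrite /coins -[D in RHS]addn0.
(* The start of the range is generalized because the first coin shifts it by one. *)
suff: forall k, Ex (run ans [seq Coin O (D + i) | i <- iota k n] m) f
    = (\sum_(w : 'cV['F_2]_n) f (store m (D + k) (bits w)))
      / #|{: 'cV['F_2]_n}|%:R by apply.
elim: n m => [|n IH] m k.
  rewrite /= (big_pred1 0) => [|w]; last by rewrite [w]flatmx0 /= eqxx.
  rewrite card_mx mul0n expn0 divr1; congr f.
  by apply: functional_extensionality => a; rewrite store_out ?size_bits //; lia.
rewrite /= sum_colS !mulr_suml; apply: eq_bigr => x _.
rewrite IH !card_mx !muln1 expnS natrM invfM -mulrA [X in _ * X]mulrC.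
congr (_ * _); apply: eq_bigr => w _; congr f.
apply: functional_extensionality => a; rewrite bits_colS /store /= size_bits.
case: (eqVneq a (D + k)%N) => [->|ne].
  rewrite addnS ltnn subnn leqnn addn1 ltnSn /= ifT //; lia.
have -> : (D + k <= a < D + k + 1)%N = false by lia.
have -> : (D + k <= a < D + k + n.+1)%N = (D + k.+1 <= a < D + k.+1 + n)%N by lia.
case: ifP => // h; rewrite (_ : a - (D + k) = (a - (D + k.+1)).+1)%N //; lia.
Qed.

(** * Simulation of the CAKE oracles *)

(** Index 0 gets the zero block, since ciphertext block 0 is the initialization vector alone; every
    ciphertext block is then [ctr E C0 i + plain_block P i]. *)
Definition plain_block (B n : nat) (P : n.-tuple (block B)) (i : nat) : block B :=
  if i is i'.+1 then P`_i' else 0.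

Lemma col_bastion (B c : nat) (E : {perm block B}) (C0 : block B)
    (P : c.-1.-tuple (block B)) (j : 'I_c) :
  col j (ctr_ciphertext E C0 P *m bastion_mx c)
    = \sum_(0 <= i < c | i != j) (ctr E C0 i + plain_block P i).
Proof.
rewrite big_mkord; apply/colP => r; rewrite !mxE summxE [RHS]big_mkcond /=.
apply: eq_bigr => i _; rewrite !mxE -val_eqE /ctr /plain_block /=.
case: (val i == val j); first by rewrite mulr0.
by rewrite mulr1; case: (nat_of_ord i) => [|k] /=; rewrite !mxE ?addr0 // addrC.
Qed.

(* The CAKE adversary only touches registers below [Z]; its simulation also
   preserves the content [h] of [Z, Q) and uses the registers from [Q] on as
   scratch memory. *)
Definition agree (Z Q : nat) (h m m' : registers) : Prop :=
  (forall a, (a < Z)%N -> m' a = m a) /\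
  (forall a, (Z <= a < Q)%N -> m' a = h a).

Lemma agree_store (Z Q : nat) (h m m' : registers) (d : nat) (s : seq 'F_2) :
  agree Z Q h m m' -> (d + size s <= Z)%N ->
  agree Z Q h (store m d s) (store m' d s).
Proof.
move=> [lo hi] ds; split=> a aZ; first by rewrite /store; case: ifP => // _; apply: lo.
by rewrite store_out ?hi //; lia.
Qed.

Lemma agree_store_out (Z Q : nat) (h m m' : registers) (d : nat) (s : seq 'F_2) :
  agree Z Q h m m' -> (Z <= Q)%N -> (Q <= d)%N ->
  agree Z Q h m (store m' d s).
Proof.
move=> [lo hi] ZQ Qd.
by split=> a aZ; rewrite store_out; first [exact: lo | exact: hi | lia].
Qed.

Section Simulation.
Variables (B c c2 : nat) (sel : index_rule) (E : {perm block B}) (real : bool).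
Variables Z Q : nat.
Hypothesis (ZQ : (Z <= Q)%N) (c_gt0 : (0 < c)%N).
Let cans := cake_oracles c E.
Let pans := pad_oracles sel c2 E real.

(** The area after [Q + c * B] receives [C0 + bin B i]; the 1 bits of [bin B i] are added from
    register [Q + c * B], which holds the constant 1. *)
Definition ctr_block (i : nat) : prog pad_oracle :=
  assign_sums _ (Q + c * B + 1) B
    (fun r => (Q + r)%N :: if bit (bin B i) r == 1 then [:: Q + c * B]%N else [::])
  ++ [:: Call PadBC (Q + c * B + 1) (Q + i * B)].

Definition ctr_blocks (n : nat) : prog pad_oracle :=
  flatten [seq ctr_block i | i <- iota 1 n].

(** Each cipher call writes its own slot [Q + i * B], so the earlier blocks, the constant 1 and the
    registers below [Q] are kept. *)
Lemma run_ctr_blocks (n : nat) (m : registers) (C0 : block B) :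
  (n < c)%N -> (forall r, (r < B)%N -> m (Q + r)%N = bit C0 r) ->
  m (Q + c * B)%N = 1 ->
  exists m', [/\ run pans (ctr_blocks n) m = Ret m',
    forall i r, (i <= n)%N -> (r < B)%N ->
      m' (Q + (i * B + r))%N = bit (ctr E C0 i) r,
    m' (Q + c * B)%N = 1 & forall a, (a < Q)%N -> m' a = m a].
Proof.
move=> nc mC0 m1; elim: n nc => [|n IH] nc.
  by exists m; split=> // i r; rewrite leqn0 => /eqP -> rB; rewrite mul0n mC0.
have [m' [run_m' m'ctr m'1 m'lo]] := IH (ltnW nc).
rewrite /ctr_blocks -[n.+1]addn1 iotaD map_cat flatten_cat /= cats0 run_cat.
rewrite -/(ctr_blocks n) run_m' /= /ctr_block run_cat run_assign_sums; last first.
  by move=> k x kB; case: ifP => _; rewrite !inE => ?; nia.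
rewrite /=; eexists; split; first by reflexivity.
- move=> i r; rewrite addn1 leq_eqVlt => /orP[/eqP -> | i_n] rB; last first.
    have lt1 := ltn_block i_n rB; have lt2 := ltn_block (ltn_trans i_n nc) rB.
    have le2 : (n.+1 * B <= c * B)%N by rewrite leq_mul2r ltnW ?orbT.
    by rewrite !store_out ?m'ctr ?size_bits ?size_mkseq //; lia.
  rewrite addnA add1n store_in ?size_bits // -/(bit _ r) /ctr /=.
  congr (bit (E _) r); apply: bitP => k kB; rewrite bit_read //.
  rewrite add0n store_in ?size_mkseq // nth_mkseq // bitD big_cons.
  have := m'ctr 0%N k isT kB; rewrite mul0n add0n => ->; congr (_ + _).
  rewrite [RHS]F2_cases; case: ifP => _; last by rewrite big_nil.
  by rewrite big_seq1.
- have le2 : (n.+1 * B + B <= c * B)%N by rewrite addnC -mulSn leq_mul2r nc orbT.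
  by rewrite !store_out ?size_bits ?size_mkseq //; lia.
- by move=> a aQ; rewrite !store_out ?m'lo //; lia.
Qed.

(** Bit [k] of the transformed ciphertext sits in column [k %/ B], at position [k %% B]; plaintext
    block [i'] accompanies counter block [i'.+1]. *)
Definition bastion_sources (src k : nat) : seq nat :=
  flatten [seq (Q + (i * B + k %% B))%N ::
                 (if i is i'.+1 then [:: src + (i' * B + k %% B)]%N else [::])
          | i <- [seq i <- iota 0 c | i != (k %/ B)%N]].

(* Counter block i lies at [Q + i * B] (block 0 being the initialization vector)
   and the constant 1 at [Q + c * B]; the ciphertext is assembled in a buffer
   because [dst] may overlap [src]. *)
Definition bastion_prog (src dst : nat) : prog pad_oracle :=
  coins _ Q B ++ One _ (Q + c * B) :: ctr_blocks c.-1
  ++ assign_sums _ (Q + c * B + 1 + B) (c * B) (bastion_sources src)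
  ++ assign_sums _ dst (c * B) (fun k => [:: Q + c * B + 1 + B + k]%N).

Lemma bastion_sourcesP (src k x : nat) :
  (k < c * B)%N -> x \in bastion_sources src k ->
  (x < Q + c * B)%N && (Q <= x)%N || (x < src + c * B)%N.
Proof.
case/block_divmod => _ rB _ /flatten_mapP[i].
rewrite mem_filter mem_iota add0n => /andP[_ /= ic].
have := ltn_block ic rB; case: i ic => [|i] ic lt1; rewrite !inE => xE; first lia.
have := ltn_block (ltnW ic) rB; lia.
Qed.

(** The coins stored at [Q] are identified with the vector drawn by the oracle; once it is fixed,
    both sides are deterministic. *)
Lemma coupled_bastion (h m m' : registers) (src dst : nat) :
  agree Z Q h m m' -> (src + c * B <= Z)%N -> (dst + c * B <= Z)%N ->
  coupled (agree Z Q h) (step cans (Call EvalBastion src dst) m)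
    (run pans (bastion_prog src dst) m').
Proof.
move=> mm' srcZ dstZ f g fg.
rewrite run_cat Ex_bind Ex_coins /=; congr (_ * _); apply: eq_bigr => C0 _.
set P := read_blocks _ _ _ _.
set m1 := store _ (Q + c * B) _.
have lt_c : (c.-1 < c)%N by rewrite prednK.
have m1C0 r : (r < B)%N -> m1 (Q + r)%N = bit C0 r.
  move=> rB; rewrite /m1 store1E ifF; last by have := ltn_block c_gt0 rB; lia.
  by rewrite store_in ?size_bits.
have m11 : m1 (Q + c * B)%N = 1 by rewrite /m1 store1E eqxx.
have [m2 [run2 m2ctr _ m2lo]] := run_ctr_blocks lt_c m1C0 m11.
have m2Z : agree Z Q h m m2.
  have [lo hi] := mm'; split=> a aZ; rewrite m2lo ?/m1 ?store1E ?ifF ?store_out;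
    first [exact: lo | exact: hi | lia].
rewrite run_cat run2 /= run_cat run_assign_sums; last first.
  by move=> k x kc /(bastion_sourcesP kc); lia.
rewrite /= run_assign_sums; last by move=> k x kc; rewrite inE => /eqP ->; lia.
rewrite /=; apply: fg.
set cols := [seq _ | j <- enum 'I_c].
set out := mkseq _ _.
have -> : bits_of_blocks cols = out.
  apply: bits_of_blocks_mkseq => [|i r ic rB]; first by rewrite size_map size_enum_ord.
  rewrite (nth_map (Ordinal ic)) ?size_enum_ord // col_bastion bit_sum.
  rewrite /bastion_sources big_flatten big_map big_filter.
  have -> : ((i * B + r) %% B)%N = r by rewrite modnMDl modn_small.
  have -> : ((i * B + r) %/ B)%N = i.
    by rewrite divnMDl ?divn_small ?addn0 //; lia.
  rewrite nth_enum_ord //.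
  have -> : iota 0 c = index_iota 0 c by rewrite /index_iota subn0.
  rewrite [LHS]big_nat_cond [RHS]big_nat_cond; apply: eq_bigr => k /andP[/andP[_ kc] _].
  rewrite bitD big_cons m2ctr //; last by rewrite -ltnS prednK.
  congr (_ + _); case: k kc => [|k] kc; first by rewrite bit0 big_nil.
  have kc' : (k < c.-1)%N by rewrite -ltnS prednK.
  rewrite big_seq1 /= /P (nth_map (Ordinal kc')) ?size_enum_ord // nth_enum_ord //.
  rewrite bit_read //.
  have lt1 := ltn_block (ltnW kc) rB.
  by case: m2Z => lo _; rewrite lo ?addnA ?add0n // -?addnA ?add0n; lia.
have -> : mkseq (fun k => \sum_(x <- [:: Q + c * B + 1 + B + k]%N)
    store m2 (Q + c * B + 1 + B) out x) (c * B) = out.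
  apply/eq_in_map => k; rewrite mem_iota add0n => /andP[_ kc].
  by rewrite big_seq1 store_in ?size_mkseq // nth_mkseq.
by apply: agree_store; rewrite ?size_mkseq //; apply: agree_store_out => //; lia.
Qed.

Definition compile_instr (i : instr cake_oracle) : prog pad_oracle :=
  match i with
  | One d => [:: One _ d]
  | Add d a b => [:: Add _ d a b]
  | Mul d a b => [:: Mul _ d a b]
  | Coin d => [:: Coin _ d]
  | Call EvalBC s d => [:: Call PadBC s d]
  | Call EvalBCinv s d => [:: Call PadBCinv s d]
  | Call EvalBastion s d => bastion_prog s d
  end.

Definition compile (p : prog cake_oracle) : prog pad_oracle :=
  flatten [seq compile_instr i | i <- p].

(* A bound on the addresses that [i] reads or writes. *)
Definition reach (i : instr cake_oracle) : nat :=
  match i with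
  | One d | Coin d => d.+1
  | Add d a b | Mul d a b => (d + a + b).+1
  | Call _ s d => (s + d + c * B)%N
  end.

Lemma read_block_agree (h m m' : registers) (s : nat) :
  agree Z Q h m m' -> (s + B <= Z)%N ->
  read_block B (fun a => m' (s + a)%N) 0 = read_block B (fun a => m (s + a)%N) 0.
Proof.
move=> [lo _] sZ; apply: bitP => r rB; rewrite !bit_read // lo //; lia.
Qed.

Lemma coupled_step (h m m' : registers) (i : instr cake_oracle) :
  agree Z Q h m m' -> (reach i <= Z)%N ->
  coupled (agree Z Q h) (step cans i m) (run pans (compile_instr i) m').
Proof.
(* [Bc] says [B <= c * B], so the term [c * B] of [reach] also covers calls on a single block. *)
move=> mm'; have [lo _] := mm'; have Bc := leq_pmull B c_gt0.
case: i => [d|d a b|d a b|d|[] s d] /= iZ.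
- by move=> f g fg; apply: fg; apply: agree_store => //=; lia.
- move=> f g fg; apply: fg; rewrite !lo; first (apply: agree_store => //=);
    lia.
- move=> f g fg; apply: fg; rewrite !lo; first (apply: agree_store => //=);
    lia.
- apply: coupled_Draw => x f g fg; apply: fg; apply: agree_store => //=; lia.
- move=> f g fg; apply: fg; rewrite (read_block_agree mm'); last lia.
  by apply: agree_store => //; rewrite size_bits; lia.
- move=> f g fg; apply: fg; rewrite (read_block_agree mm'); last lia.
  by apply: agree_store => //; rewrite size_bits; lia.
by apply: coupled_bastion => //; lia.
Qed.

(** The simulation is perfect: the pad oracles evaluate the cipher under the same exposed key, so
    encryption queries can be computed inside the program. *)
Lemma coupled_run (h m m' : registers) (p : prog cake_oracle) :
  agree Z Q h m m' -> all (fun i => reach i <= Z)%N p ->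
  coupled (agree Z Q h) (run cans p m) (run pans (compile p) m').
Proof.
elim: p m m' => [|i p IH] m m' mm' /=; first by move=> _ f g; apply.
case/andP=> iZ pZ; rewrite /compile /= run_cat.
apply: coupled_bind; first exact: coupled_step mm' iZ.
by move=> a a' aa'; apply: IH.
Qed.

(** * Size and query counts of the simulation *)

Lemma size_ctr_blocks (n : nat) : (size (ctr_blocks n) <= n * (B * 3 + 1))%N.
Proof.
rewrite /ctr_blocks; elim: n => // n IH.
rewrite -[n.+1]addn1 iotaD map_cat flatten_cat /= cats0 !size_cat /= mulnDl mul1n.
rewrite leq_add // leq_add2r; apply: size_assign_sums => k _.
by case: ifP.
Qed.

Lemma size_bastion_prog (s d : nat) :
  (size (bastion_prog s d) <= 6 * B.+1 * c.+1 ^ 2)%N.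
Proof.
clear ZQ; have src_le : (size (assign_sums pad_oracle (Q + c * B + 1 + B) (c * B)
      (bastion_sources s)) <= c * B * (c * 2).+1)%N.
  apply: size_assign_sums => k _; rewrite /bastion_sources size_flatten /shape -map_comp.
  apply: leq_trans (_ : size [seq i <- iota 0 c | i != (k %/ B)%N] * 2 <= _)%N.
    elim: [seq i <- _ | _] => //= i l IH; rewrite mulSn leq_add //.
    by case: i.
  by rewrite leq_mul2r size_filter -[X in (_ <= X)%N](size_iota 0) count_size orbT.
have dst_le : (size (assign_sums pad_oracle d (c * B) (fun k => [:: Q + c * B + 1 + B + k]%N))
    <= c * B * 2)%N by apply: size_assign_sums.
have := size_ctr_blocks c.-1.
rewrite /bastion_prog size_cat /= !size_cat size_map size_iota => ctr_le.
have : (c.-1 * (B * 3 + 1) <= c * (B * 3 + 1))%N by rewrite leq_mul2r leq_pred orbT.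
move: src_le dst_le ctr_le; rewrite -mulnn.
move: (size _) (size _) (size _) => x y z; nia.
Qed.

Lemma size_compile (p : prog cake_oracle) :
  (size (compile p) <= size p * (6 * B.+1 * c.+1 ^ 2))%N.
Proof.
clear ZQ; rewrite /compile; elim: p => //= i p IH; rewrite size_cat mulSn leq_add // {p IH}.
have pos : (0 < 6 * B.+1 * c.+1 ^ 2)%N by rewrite !muln_gt0.
by case: i => [d|d a b|d a b|d|[] s d] //; apply: size_bastion_prog.
Qed.

Lemma queries_ctr_blocks (n : nat) : queries (ctr_blocks n) = n.
Proof.
rewrite /queries /ctr_blocks; elim: n => // n IH.
rewrite -[n.+1]addn1 iotaD map_cat flatten_cat /= cats0 !count_cat IH /=.
by have := queries_assign_sums; rewrite /queries => ->.
Qed.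

Lemma queries_cat (O : Type) (p q : prog O) :
  queries (p ++ q) = (queries p + queries q)%N.
Proof. exact: count_cat. Qed.

Lemma queries_bastion_prog (s d : nat) : queries (bastion_prog s d) = c.-1.
Proof.
rewrite /bastion_prog queries_cat -cat1s !queries_cat queries_ctr_blocks.
rewrite !queries_assign_sums /= !addn0 /queries /coins count_map.
by rewrite -[RHS]add0n; congr addn; elim: (iota 0 B).
Qed.

(** An encryption query becomes [c.-1] blockcipher queries, and any other query remains a single
    one. *)
Lemma queries_compile (p : prog cake_oracle) :
  (queries (compile p) <= queries p * c)%N.
Proof.
rewrite /compile; elim: p => //= i p IH; rewrite queries_cat mulnDl leq_add // {p IH}.
case: i => [d|d a b|d a b|d|[] s d] //=; rewrite mul1n //.
by rewrite queries_bastion_prog leq_pred.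
Qed.

End Simulation.

(** * The revealed blocks as functions of the pad *)

Lemma block_addxx (B : nat) (w : block B) : w + w = 0.
Proof. by apply/colP => r; rewrite !mxE F2_addxx. Qed.

Lemma block_mulrn (B n : nat) (w : block B) : w *+ n = if odd n then w else 0.
Proof.
elim: n => // n IH; rewrite mulrS IH /=.
by case: (odd n); rewrite ?block_addxx ?addr0.
Qed.

Section PadAlgebra.
Variables (B c c2 : nat) (s t u : 'I_c2).

Definition others : seq 'I_c2 := [seq i <- enum 'I_c2 | i \notin [:: s; t; u]].

(** The pad as a linear map of any family [x]: counter blocks give [pad], plaintext blocks give the
    translation that a uniform pad hides. *)
Definition padf (x : nat -> block B) : seq (block B) :=
  (x s + x t + x u) :: [seq x u + x (i : 'I_c2) | i <- others].

(* The j-th transformed block without its plaintext part, as a sum of blocks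
   of the pad. *)
Definition view (w : seq (block B)) (j : nat) : block B :=
  (if odd c then 0 else w`_0)
  + \sum_(i <- others | (i < c)%N && (i != j :> nat)) w`_(index i others).+1.

Lemma viewD (w w1 w2 : seq (block B)) (j : nat) :
  (forall k, w`_k = w1`_k + w2`_k) -> view w j = view w1 j + view w2 j.
Proof.
move=> ww; rewrite /view addrACA -big_split /=; congr (_ + _).
  by case: odd; rewrite ?addr0.
by apply: eq_bigr.
Qed.

(** [view] is additive and translation by [d] permutes the tuples, being an involution in
    characteristic 2. The bound on [size d] makes all entries beyond [n] the default 0. *)
Lemma sum_view_shift (n : nat) (d : seq (block B)) (l : seq nat)
    (G : seq (block B) -> rat) :
  (size d <= n)%N ->
  \sum_(R : n.-tuple (block B)) G [seq view R j + view d j | j <- l]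
    = \sum_(R : n.-tuple (block B)) G [seq view R j | j <- l].
Proof.
move=> dn; pose sh (R : n.-tuple (block B)) := [tuple tnth R i + d`_i | i < n].
have shK : involutive sh.
  move=> R; apply: eq_from_tnth => i; rewrite !tnth_mktuple -addrA.
  by rewrite block_addxx addr0.
rewrite [RHS](reindex sh); last by exists sh => R _; apply: shK.
apply: eq_bigr => R _; congr G; apply: eq_map => j; apply/esym/viewD => k.
have [kn|nk] := ltnP k n; last first.
  by rewrite !nth_default ?addr0 ?size_tuple ?(leq_trans dn nk).
have := tnth_mktuple (fun i => tnth R i + d`_i) (Ordinal kn).
by rewrite !(tnth_nth 0).
Qed.

Hypotheses (c_gt2 : (2 < c)%N) (c2E : c2 = (c + (odd c).*2)%N).
Hypotheses (st : s != t) (us : u != s) (ut : u != t).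

Lemma size_others : size others = (c2 - 3)%N.
Proof.
rewrite /others -sum1_size big_filter big_enum_cond /= sum1_card.
have := cardC (mem [:: s; t; u]); rewrite card_ord (card_uniqP _) /=; last first.
  by rewrite !inE negb_or st !(eq_sym _ u) us ut.
by move=> cE; rewrite -[X in (X - 3)%N]cE addKn.
Qed.

Lemma size_padf (x : nat -> block B) : size (padf x) = (c2 - 2)%N.
Proof. by rewrite /= size_map size_others; lia. Qed.

Hypothesis st_big : odd c -> (c <= s)%N /\ (c <= t)%N.

(** There are [c.-1] indices below [c] other than [j]. For odd [c] this is even, so the copies of
    [x u] in the terms [x u + x i] cancel. For even [c] one copy of [x u] is left over and the terms
    of [s] and [t] are missing; the first pad block [x s + x t + x u] corrects both. *)
Lemma view_padf (x : nat -> block B) (j : nat) :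
  (j < c)%N -> j != s -> j != t ->
  view (padf x) j = \sum_(0 <= i < c | i != j) x i.
Proof.
move=> jc js jt; have cc2 : (c <= c2)%N by rewrite c2E leq_addr.
(* For odd [c], [s] and [t] occupy the only two indices that are at least [c]; for even [c], [c2] is
   [c]. *)
have uc : (u < c)%N.
  have := ltn_ord u; have := ltn_ord s; have := ltn_ord t.
  move: st us ut; rewrite -!val_eqE /=; move: c2E st_big.
  by case: (odd c) => /= cE; [move=> /(_ isT)[cs ct]|move=> _]; lia.
have sumE (F : nat -> block B) : \sum_(0 <= i < c | i != j) F i
    = \sum_(i < c2 | (i < c)%N && (i != j :> nat)) F i.
  rewrite big_mkord (big_ord_widen_cond c2 (fun i => i != j) F cc2).
  by apply: eq_bigl => i; rewrite andbC.
have shift : \sum_(0 <= i < c | i != j) (x u + x i)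
    = \sum_(0 <= i < c | i != j) x i + (if odd c then 0 else x u).
  rewrite big_split /= addrC; congr (_ + _).
  rewrite big_mkord sumr_const block_mulrn.
  have := cardC1 (Ordinal jc); rewrite card_ord => cE.
  rewrite (_ : #|_| = c.-1); last by rewrite -cE; apply: eq_card => i; rewrite !inE.
  by rewrite -[in RHS](ltn_predK c_gt2) /=; case: odd.
rewrite /view; set T := \sum_(i <- _ | _) _.
have -> : T = \sum_(i < c2 | [&& i \notin [:: s; t; u], (i < c)%N & i != j :> nat]) (x u + x i).
  rewrite /T big_seq_cond.
  under eq_bigr => i /andP[io _].
    rewrite /= (nth_map i) ?index_mem // nth_index //; over.
  rewrite -big_seq_cond /others big_filter_cond big_enum_cond /=.
  by apply: eq_bigl => i; rewrite andbA.
move: shift; rewrite !sumE => {sumE T}.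
(* The sum is split into the terms listed in the pad and those of index [s], [t] or [u]. For odd [c]
   only [u] can be in range among the latter, and [x u + x u] vanishes. *)
rewrite (bigID (fun i : 'I_c2 => i \notin [:: s; t; u])) /=.
under eq_bigl => i do rewrite andbC.
set rest := \sum_(i < c2 | _) _; set tot := \sum_(i < c2 | _) x i.
case: (boolP (odd c)) => [/st_big[cs ct]|codd].
  rewrite big1 ?addr0 ?add0r // => i /andP[/andP[ic _]]; rewrite negbK !inE.
  by case/or3P => /eqP ie; rewrite ie ?block_addxx // in ic *; lia.
have ltc (i : 'I_c2) : (i < c)%N by have := ltn_ord i; move: c2E; rewrite (negbTE codd); lia.
(* For even [c] the terms of [s] and [t] do occur, because [j] is neither of them. *)
rewrite (bigD1 s) /=; last by rewrite ltc negbK !inE eqxx eq_sym js.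
rewrite (bigD1 t) /=; last by rewrite ltc negbK !inE eqxx orbT eq_sym jt eq_sym st.
rewrite big1 ?addr0 => [|i]; last first.
  rewrite negbK !inE => /andP[/andP[/andP[_ i3] /negbTE i_s] /negbTE i_t].
  by move: i3; rewrite i_s i_t => /eqP ->; rewrite block_addxx.
move=> sumE; apply: (addIr (x u)); rewrite -sumE.
rewrite [x u + x s + _]addrACA block_addxx add0r [LHS]addrAC.
by rewrite -(addrA _ (x u) (x u)) block_addxx addr0 addrC.
Qed.

End PadAlgebra.

(** * The pad adversary *)

Lemma read_index_delta (c : nat) (m : registers) (a : nat) (i : 'I_c) :
  (forall r, (r < c)%N -> m (a + r)%N = (r == i)%:R) -> read_index c m a = Some i.
Proof.
move=> mi; rewrite /read_index.
have -> : read_block c m a = delta_mx i 0.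
  by apply/colP => r; rewrite !mxE mi // andbT.
case: pickP => [k /eqP/colP/(_ i)|/(_ i)]; last by rewrite eqxx.
by rewrite !mxE !eqxx andbT /=; case: eqP => // ->.
Qed.

(** The randomness of a pad query, separated from the encoding of its answer as bits. *)
Definition pad_source (B c2 : nat) (E : {perm block B}) (real : bool)
    (s t u : 'I_c2) : exper (seq (block B)) :=
  if real then Draw (fun C0 : block B => Ret (pad E C0 s t u))
  else Draw (fun R : (c2 - 2).-tuple (block B) => Ret (R : seq _)).

Lemma pad_oracleE (B c2 : nat) (sel : index_rule) (E : {perm block B}) (real : bool)
    (m : registers) (s t : 'I_c2) :
  read_index c2 m 0 = Some s -> read_index c2 m c2 = Some t -> s != t ->
  pad_oracles sel c2 E real PadQuery m
    = bind (pad_source E real s t (sel B c2 s t))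
        (fun w => Ret (bits_of_index (sel B c2 s t) ++ bits_of_blocks w)).
Proof. by move=> /= -> -> /negbTE ->; case: real. Qed.

Section Attack.
Variables (B c c2 : nat) (sel : index_rule) (A : cake_adversary).
Variables (S0 : {set 'I_c}) (s t : 'I_c2) (b : bool).
Let u := @sel B c2 s t.

(* [room, flag) keeps a copy of the plaintext P^b, and register [flag] whether the
   chosen positions are [S0]. *)
Definition room : nat :=
  (sumn [seq reach B c i | i <- adv_find A ++ adv_choose A ++ adv_guess A]
   + 2 * c * B + c + 1)%N.
Definition flag : nat := (room + c.-1 * B)%N.
Definition temp : nat := flag.+1.
Definition plain_at : nat := if b then (c.-1 * B)%N else 0%N.
Definition answer_at : nat := (temp.+1 + (c2 + c2))%N.
Definition positions : seq nat := [seq val i | i <- enum 'I_c & i \in S0].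

(** Over F_2, the indicator that the chosen set is [S0] is the product of the [r_i] for [i] in [S0]
    and of the [1 + r_i] for the other [i]. *)
Definition flag_step (i : 'I_c) : prog pad_oracle :=
  if i \in S0 then [:: Mul _ flag flag i]
  else [:: One _ temp; Add _ temp temp i; Mul _ flag flag temp].

Definition flag_prog : prog pad_oracle :=
  One _ flag :: flatten [seq flag_step i | i <- enum 'I_c].

Definition query_prog : prog pad_oracle :=
  One _ temp
  :: assign_sums _ temp.+1 (c2 + c2)
       (fun k => if (k == s :> nat) || (k == c2 + t)%N then [:: temp] else [::])
  ++ [:: Call PadQuery temp.+1 answer_at].

(** The answer opens with the [c2] bits naming [u], hence the offset [answer_at + c2]; pad block 0
    is the three-term sum, hence the successor on [index]. The first two lists compute [view], the
    third adds the saved plaintext. *)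
Definition reply_sources (k : nat) : seq nat :=
  let r := (k %% B)%N in
  let j := nth 0%N positions (k %/ B) in
  (if odd c then [::] else [:: answer_at + c2 + r]%N)
  ++ [seq (answer_at + c2 + ((index i (others s t u)).+1 * B + r))%N
     | i : 'I_c2 <- others s t u & (i < c)%N && (i != j :> nat)]
  ++ [seq (room + (i.-1 * B + r))%N | i <- iota 0 c & (i != 0%N) && (i != j)].

(** The pad is requested after the positions are chosen, whereas the game encrypts before; the
    choice stage does not see the challenge, so the order is immaterial. *)
Definition attack : prog pad_oracle :=
  compile B c temp (adv_find A)
  ++ assign_sums _ room (c.-1 * B) (fun k => [:: plain_at + k]%N)
  ++ compile B c temp (adv_choose A)
  ++ flag_prog ++ query_prog
  ++ assign_sums _ 0 (#|S0| * B) reply_sources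
  ++ compile B c temp (adv_guess A)
  ++ [:: Mul _ 0 0 flag].

Definition reply (w : seq (block B)) (P : c.-1.-tuple (block B)) : seq (block B) :=
  [seq view c s t u w j + \sum_(0 <= i < c | i != j) plain_block P i | j <- positions].

Variables (E : {perm block B}) (real : bool).
Hypotheses (c_gt2 : (2 < c)%N) (c2E : c2 = (c + (odd c).*2)%N).
Hypotheses (st : s != t) (us : u != s) (ut : u != t).
Let cans := cake_oracles c E.
Let pans := pad_oracles sel c2 E real.

Lemma size_positions : size positions = #|S0|.
Proof. by rewrite size_map -sum1_size big_filter big_enum_cond sum1_card. Qed.

Lemma room_le_flag : (room <= flag)%N.
Proof. exact: leq_addr. Qed.

Lemma all_reach (p : prog cake_oracle) :
  (sumn [seq reach B c i | i <- p] <= room)%N -> all (fun i => reach B c i <= room)%N p.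
Proof.
by move: room => z; elim: p => //= i p IH pz; apply/andP; split; [lia|apply: IH; lia].
Qed.

Lemma run_flag (m : registers) :
  exists m', [/\ run pans flag_prog m = Ret m',
    m' flag = ([set i : 'I_c | m i == 1] == S0)%:R
    & forall a, a != flag -> a != temp -> m' a = m a].
Proof.
have lt_room (i : 'I_c) : (i < room)%N by have := ltn_ord i; rewrite /room; lia.
have loop (l : seq 'I_c) m0 : exists m', [/\
    run pans (flatten [seq flag_step i | i <- l]) m0 = Ret m',
    m' flag = m0 flag * (all (fun i : 'I_c => (m0 i == 1) == (i \in S0)) l)%:R
    & forall a, a != flag -> a != temp -> m' a = m0 a].
  elim: l m0 => [|i l IH] m0; first by exists m0; rewrite mulr1.
  have [m1 [run1 flag1 keep1]] : exists m1, [/\ run pans (flag_step i) m0 = Ret m1,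
      m1 flag = m0 flag * ((m0 i == 1) == (i \in S0))%:R
      & forall a, a != flag -> a != temp -> m1 a = m0 a].
    rewrite /flag_step; case: ifP => _ /=; eexists; split; try reflexivity.
    - by rewrite store1E eqxx [m0 i in LHS]F2_cases; case: (m0 i == 1).
    - by move=> a af _; rewrite store1E (negbTE af).
    - have lti : (i == temp :> nat) = false.
        by have := lt_room i; have := room_le_flag; rewrite /temp; lia.
      have ft : (flag == temp) = false by rewrite /temp; lia.
      rewrite !store1E !eqxx ft lti [m0 i in LHS]F2_cases; case: (m0 i == 1) => /=.
        by rewrite F2_addxx.
      by congr (_ * _); apply: val_inj.
    - by move=> a af at_; rewrite !store1E (negbTE af) (negbTE at_).
  have [m2 [run2 flag2 keep2]] := IH m1.
  exists m2; split; first by rewrite /= run_cat run1.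
    rewrite flag2 flag1 /= -mulrA -natrM mulnb; congr (_ * (_ && _)%:R).
    apply: eq_all => k; rewrite keep1 //; have := lt_room k; have := room_le_flag;
      rewrite /temp; lia.
  by move=> a af at_; rewrite keep2 // keep1.
have [m' [run' flag' keep']] := loop (enum 'I_c) (store m flag [:: 1]).
exists m'; split => //; last by move=> a af at_; rewrite keep' // store1E (negbTE af).
rewrite flag' store1E eqxx mul1r; congr (nat_of_bool _)%:R.
apply/allP/eqP => [h|h i _].
  apply/setP => i; have := h i (mem_enum _ i); rewrite inE store1E.
  by rewrite ifF => [/eqP //|]; have := lt_room i; have := room_le_flag; lia.
rewrite -h inE store1E ifF //; have := lt_room i; have := room_le_flag; lia.
Qed.

Lemma run_query (m : registers) :
  exists m', (forall a, (a < temp)%N -> m' a = m a) /\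
    run pans query_prog m = bind (pad_source E real s t u)
      (fun w => Ret (store m' answer_at (bits_of_index u ++ bits_of_blocks w))).
Proof.
set v := fun k : nat => if (k == s :> nat) || (k == c2 + t)%N then [:: temp] else [::].
pose m' := store (store m temp [:: 1]) temp.+1
  (mkseq (fun k => \sum_(x <- v k) store m temp [:: 1] x) (c2 + c2)).
exists m'; split.
  by move=> a a_lt; rewrite /m' store_out ?store1E ?ifF //; lia.
have -> : run pans query_prog m = run pans [:: Call PadQuery temp.+1 answer_at] m'.
  rewrite /query_prog /= run_cat run_assign_sums // => k x kc; case: ifP => // _.
  by rewrite inE => /eqP ->; rewrite ltnSn.
have m'E k : (k < c2 + c2)%N -> m' (temp.+1 + k)%N = ((k == s) || (k == c2 + t)%N)%:R.
  move=> kc; rewrite /m' store_in ?size_mkseq // nth_mkseq //.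
  by rewrite /v; case: ifP => _; rewrite ?big_nil // big_seq1 store1E eqxx.
rewrite run_call /pans (@pad_oracleE _ _ _ _ _ _ s t) //.
- by rewrite bindA.
- apply: read_index_delta => r rc; rewrite add0n m'E; last by lia.
  by congr (nat_of_bool _)%:R; lia.
- apply: read_index_delta => r rc; rewrite m'E; last by lia.
  by congr (nat_of_bool _)%:R; have := ltn_ord s; lia.
Qed.

Lemma sum_reply_sources (m : registers) (w : seq (block B))
    (P : c.-1.-tuple (block B)) (k : nat) :
  size w = (c2 - 2)%N ->
  (forall i r, (i < c2 - 2)%N -> (r < B)%N ->
     m (answer_at + c2 + (i * B + r))%N = bit w`_i r) ->
  (forall i r, (i < c.-1)%N -> (r < B)%N -> m (room + (i * B + r))%N = bit P`_i r) ->
  (k < #|S0| * B)%N ->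
  \sum_(x <- reply_sources k) m x = (bits_of_blocks (reply w P))`_k.
Proof.
move=> sw mw mP; case/block_divmod => jS rB kE.
rewrite [in RHS]kE nth_bits_of_blocks // (nth_map 0%N) ?size_positions //.
rewrite /reply_sources.
set r := (k %% B)%N in rB *; set j := nth _ _ _.
rewrite !big_cat /= !big_map !big_filter bitD bitD !bit_sum -addrA; congr (_ + (_ + _)).
- case: ifP => _; first by rewrite big_nil bit0.
  by rewrite big_seq1; have := mw 0%N r; rewrite mul0n add0n => -> //; lia.
- rewrite big_seq_cond [RHS]big_seq_cond; apply: eq_bigr => i /andP[io _].
  rewrite mw //; move: io; rewrite -index_mem (size_others st us ut); lia.
rewrite /index_iota subn0 [LHS]big_mkcond [RHS]big_mkcond /=.
apply: eq_big_seq => -[|i]; first by rewrite bit0 if_same.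
rewrite mem_iota add0n => /andP[_ ic] /=; rewrite mP //; lia.
Qed.

(** Each stage is coupled with its compiled form through the registers below [room]. The reference
    memory of [agree] is renewed between stages, so that first the saved plaintext and then the flag
    survive the scratch work. *)
Lemma Ex_attack (m0 : registers) :
  #|S0| = (c - 2)%N ->
  Ex (run pans attack m0) (fun m => (m 0%N == 1)%:R)
  = Ex (run cans (adv_find A) m0) (fun m1 =>
    Ex (run cans (adv_choose A) m1) (fun m2 =>
    Ex (pad_source E real s t u) (fun w =>
    Ex (run cans (adv_guess A)
         (store m2 0 (bits_of_blocks (reply w (read_blocks B c.-1 m1 plain_at)))))
      (fun m3 => (([set i : 'I_c | m2 i == 1] == S0) && (m3 0%N == 1))%:R)))).
Proof.
move=> cS0; have c_gt0 : (0 < c)%N by lia.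
have ZQ : (room <= temp)%N by have := room_le_flag; rewrite /temp; lia.
have plainZ : (plain_at + c.-1 * B <= room)%N.
  have : (c.-1 * B <= c * B)%N by rewrite leq_mul2r leq_pred orbT.
  by rewrite /plain_at /room -mulnA; case: b; lia.
have guessZ : ((c - 2) * B <= room)%N.
  have : ((c - 2) * B <= c * B)%N by rewrite leq_mul2r leq_subr orbT.
  by rewrite /room -mulnA; lia.
have [findZ chooseZ guessZ'] : [/\ all (fun i => reach B c i <= room)%N (adv_find A),
    all (fun i => reach B c i <= room)%N (adv_choose A)
    & all (fun i => reach B c i <= room)%N (adv_guess A)].
  by split; apply: all_reach; rewrite /room !map_cat !sumn_cat; lia.
rewrite /attack run_cat Ex_bind; symmetry.
have agree0 : agree room temp m0 m0 m0 by split.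
apply: (coupled_run c2 sel E real ZQ c_gt0 agree0 findZ) => m1 m1' [lo1 _].
have bindRet k (m : registers) : bind (Ret m) k = k m :> exper registers by [].
rewrite run_cat run_assign_sums ?bindRet; last first.
  by move=> k x kB; rewrite inE => /eqP ->; lia.
set h := store m1' room _; set P := read_blocks _ _ _ _.
have hP i r : (i < c.-1)%N -> (r < B)%N -> h (room + (i * B + r))%N = bit P`_i r.
  move=> ic rB; have lt1 := ltn_block ic rB.
  rewrite /h store_in ?size_mkseq // nth_mkseq // big_seq1 lo1; last by lia.
  by rewrite (nth_map (Ordinal ic)) ?size_enum_ord // bit_read // nth_enum_ord // addnA.
have agree1 : agree room temp h m1 h.
  by split=> // a aZ; rewrite /h store_out ?lo1 ?aZ.
rewrite run_cat Ex_bind.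
apply: (coupled_run c2 sel E real ZQ c_gt0 agree1 chooseZ) => m2 m2' [lo2 hi2].
have [m3 [run3 flag3 keep3]] := run_flag m2'.
rewrite run_cat run3 bindRet run_cat.
have [m4 [keep4 run4]] := run_query m3.
rewrite run4 bindA Ex_bind.
(* The length of [w] is carried along to check that the addresses read lie within the answer. *)
have coupled_source : coupled (fun w w' => w = w' /\ size w = (c2 - 2)%N)
    (pad_source E real s t u) (pad_source E real s t u).
  rewrite /pad_source; case: real; apply: coupled_Draw => x f g fg; apply: fg.
    by split=> //; exact: (size_padf c_gt2 c2E st us ut (ctr E x)).
  by split=> //; rewrite size_tuple.
apply: coupled_source => w _ [<- sw]; rewrite bindRet.
set m5 := store m4 answer_at _.
have keep5 a : (a < temp)%N -> m5 a = m3 a.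
  by move=> a_lt; rewrite /m5 store_out ?keep4 //; rewrite /answer_at; lia.
have keep35 a : (a < flag)%N -> m5 a = m2' a.
  by move=> a_lt; rewrite keep5 ?keep3 //; rewrite /temp; lia.
have size_reply : size (reply w P) = #|S0| by rewrite size_map size_positions.
have -> : run pans (assign_sums pad_oracle 0 (#|S0| * B) reply_sources
      ++ compile B c temp (adv_guess A) ++ [:: Mul pad_oracle 0 0 flag]) m5
    = run pans (compile B c temp (adv_guess A) ++ [:: Mul pad_oracle 0 0 flag])
        (store m5 0 (bits_of_blocks (reply w P))).
  rewrite run_cat run_assign_sums ?bindRet.
    congr (run _ _ (store _ _ _)); apply: (@eq_from_nth _ 0).
      by rewrite size_mkseq size_bits_of_blocks size_reply.
    move=> k; rewrite size_mkseq => kS; rewrite nth_mkseq //.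
    apply: sum_reply_sources => // i r ic rB.
      have lt1 := ltn_block ic rB.
      rewrite /m5 -addnA store_in; last first.
        by rewrite size_cat size_bits size_bits_of_blocks sw ltn_add2l.
      by rewrite nth_cat size_bits ltnNge leq_addr addKn nth_bits_of_blocks.
    have lt1 := ltn_block ic rB.
    by rewrite keep35 ?hi2 ?hP //; rewrite /temp /flag; lia.
  move=> k x kS; have [jS rB _] := block_divmod kS.
  rewrite cS0 !mem_cat /reply_sources => /or3P[].
  - case: ifP => //; rewrite inE => _ /eqP ->.
    by have := room_le_flag; rewrite /answer_at /temp; lia.
  - by case/mapP => i _ ->; have := room_le_flag; rewrite /answer_at /temp; lia.
  - by case/mapP => i _ ->; lia.
rewrite run_cat Ex_bind.
have agree5 : agree room temp m5 m2 m5.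
  by split=> // a aZ; rewrite keep35 ?lo2 //; have := room_le_flag; lia.
have agree6 : agree room temp m5 (store m2 0 (bits_of_blocks (reply w P)))
    (store m5 0 (bits_of_blocks (reply w P))).
  by apply: agree_store; rewrite // size_bits_of_blocks size_reply cS0.
apply: (coupled_run c2 sel E real ZQ c_gt0 agree6 guessZ') => m6 m6' [lo6 hi6] /=.
rewrite store1E eqxx (hi6 flag); last by have := room_le_flag; rewrite /temp; lia.
rewrite keep5 // flag3 lo6; last by rewrite /room; lia.
have -> : [set i : 'I_c | m2' i == 1] = [set i : 'I_c | m2 i == 1].
  by apply/setP => i; rewrite !inE lo2 //; have := ltn_ord i; rewrite /room; lia.
by case: eqP => _; rewrite ?mulr1 ?mulr0.
Qed.

End Attack.

(** * The hybrid argument *)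

Lemma size_flag_prog (B c : nat) (A : cake_adversary) (S0 : {set 'I_c}) :
  (size (flag_prog B A S0) <= (3 * c).+1)%N.
Proof.
rewrite /flag_prog /= ltnS -[X in (_ <= _ * X)%N]size_enum_ord.
elim: (enum 'I_c) => //= i l IH; rewrite size_cat mulnS leq_add //.
by rewrite /flag_step; case: ifP.
Qed.

Lemma queries_flag_prog (B c : nat) (A : cake_adversary) (S0 : {set 'I_c}) :
  queries (flag_prog B A S0) = 0%N.
Proof.
rewrite /flag_prog -cat1s queries_cat; elim: (enum 'I_c) => //= i l IH.
by rewrite queries_cat addnCA IH addn0 /flag_step; case: ifP.
Qed.

(** In units of [B.+1 * c2.+1 ^ 2], a compiled instruction costs at most 6 and all the other parts
    together at most 20. *)
Lemma size_attack (B c c2 : nat) (sel : index_rule) (A : cake_adversary)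
    (S0 : {set 'I_c}) (s t : 'I_c2) (b : bool) :
  (0 < c)%N -> (c <= c2)%N ->
  (size (attack B sel A S0 s t b) <= (cake_size A).+1 * (20 * B.+1 * c2.+1 ^ 2))%N.
Proof.
move=> c_gt0 cc2.
have reply_le : (size (assign_sums pad_oracle 0 (#|S0| * B)
    (reply_sources B sel A S0 s t)) <= c * B * (1 + (c2 + c)).+1)%N.
  apply: (@leq_trans (#|S0| * B * (1 + (c2 + c)).+1)).
    apply: size_assign_sums => k _; rewrite /reply_sources !size_cat !size_map !size_filter.
    apply: leq_add; first by case: ifP.
    apply: leq_add.
      apply: leq_trans (count_size _ _) _; rewrite size_filter.
      by apply: leq_trans (count_size _ _) _; rewrite size_enum_ord.
    by rewrite -[X in (_ <= X)%N](size_iota 0) count_size.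
  by rewrite leq_mul2r leq_mul2r -[X in (_ <= X)%N]card_ord max_card !orbT.
have copy_le : (size (assign_sums pad_oracle (room B c A) (c.-1 * B)
    (fun k => [:: plain_at B c b + k]%N)) <= c.-1 * B * 2)%N.
  exact: size_assign_sums.
have query_le : (size (query_prog B c A s t) <= (c2 + c2) * 2 + 2)%N.
  rewrite /query_prog /= size_cat /= addn1 addn2 !ltnS.
  by apply: size_assign_sums => k _; case: ifP.
have flag_le := size_flag_prog B A S0.
have compile_le p : (size (compile B c (temp B c A) p) <= size p * (6 * (B.+1 * c2.+1 ^ 2)))%N.
  apply: leq_trans (size_compile _ _ c_gt0 _) _.
  by rewrite leq_mul2l mulnA leq_mul2l leq_exp2r // ltnS cc2 !orbT.
rewrite /attack !size_cat [size [:: _]]/= -mulnA /cake_size.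
set k := (B.+1 * c2.+1 ^ 2)%N in compile_le *.
have kE : k = (B.+1 * (c2.+1 * c2.+1))%N by rewrite mulnn.
have reply_k : (c * B * (1 + (c2 + c)).+1 <= 4 * k)%N.
  apply: (@leq_trans (c2.+1 * B.+1 * (2 * c2.+1))); last by rewrite kE; lia.
  by apply: leq_mul; [apply: leq_mul; lia|lia].
have copy_k : (c.-1 * B * 2 <= 2 * k)%N.
  apply: (@leq_trans (c2.+1 * B.+1 * 2)); first by rewrite leq_mul2r leq_mul; lia.
  by rewrite kE; nia.
have lin_k : (c2.+1 <= k)%N by rewrite kE mulnA leq_pmull.
move: (compile_le (adv_find A)) (compile_le (adv_choose A)) (compile_le (adv_guess A)).
move: (size (compile _ _ _ _)) (size (compile _ _ _ _)) (size (compile _ _ _ _)).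
move: (size (adv_find A)) (size (adv_choose A)) (size (adv_guess A)).
move: reply_le copy_le query_le flag_le.
move: (size _) (size _) (size _) (size _) => n1 n2 n3 n4.
move: reply_k copy_k lin_k cc2; clear; move: (c * B * _)%N (c.-1 * B * _)%N => y z.
move=> h1 h2 h3 h4 h5 h6 h7 h8 p1 p2 p3 s1 s2 s3 h9 h10 h11; clearbody k.
rewrite mulnCA in h9; rewrite mulnCA in h10; rewrite mulnCA in h11.
rewrite mulSn !mulnDl !(mulnCA _ 20%N); lia.
Qed.

Lemma queries_attack (B c c2 : nat) (sel : index_rule) (A : cake_adversary)
    (S0 : {set 'I_c}) (s t : 'I_c2) (b : bool) :
  (0 < c)%N ->
  (queries (attack B sel A S0 s t b) <= cake_queries A * c + 1)%N.
Proof.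
move=> c_gt0; rewrite /attack !queries_cat !queries_assign_sums queries_flag_prog.
have -> : queries (query_prog B c A s t) = 1%N.
  by rewrite /query_prog -cat1s !queries_cat queries_assign_sums.
have := queries_compile B (temp B c A) c_gt0 (adv_find A).
have := queries_compile B (temp B c A) c_gt0 (adv_choose A).
have := queries_compile B (temp B c A) c_gt0 (adv_guess A).
rewrite /cake_queries !mulnDl [queries [:: _]]/=.
move: (queries (compile _ _ _ _)) (queries (compile _ _ _ _)) (queries (compile _ _ _ _)).
lia.
Qed.

Section Hybrid.
Variables (BC : blockcipher) (B c c2 : nat) (sel : index_rule) (A : cake_adversary).
Hypotheses (c_gt2 : (2 < c)%N) (c2E : c2 = (c + (odd c).*2)%N).

Local Notation cans K := (cake_oracles c (cipher K)).
Local Notation start K := (store (fun=> 0) 0 (bits K)).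
Local Notation chosen m := [set i : 'I_c | m (nat_of_ord i) == 1].

(* The game for a fixed bit [b], with the chosen positions in the output. *)
Definition branch (b : bool) : exper ({set 'I_c} * bool) :=
  Draw (fun K : 'cV['F_2]_(keylen BC B) =>
  bind (run (cans K) (adv_find A) (start K)) (fun m1 =>
  bind (bastion (cipher K) (read_blocks B c.-1 m1 (plain_at B c b))) (fun C' =>
  bind (run (cans K) (adv_choose A) m1) (fun m2 =>
  bind (run (cans K) (adv_guess A) (reveal C' (chosen m2) m2)) (fun m3 =>
  Ret (chosen m2, m3 0%N == 1)))))).

Lemma lossless_cake (E : {perm block B}) o m : lossless (cake_oracles c E o m).
Proof. by case: o => // r; rewrite Ex_bind; apply: (lossless_Draw (0 : block B)). Qed.

Lemma lossless_branch b : lossless (branch b).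
Proof.
apply: (lossless_Draw 0) => K.
apply: lossless_bind => [|m1]; first by apply: lossless_run; apply: lossless_cake.
apply: lossless_bind => [|C']; first exact: (lossless_Draw (0 : block B)).
apply: lossless_bind => [|m2]; first by apply: lossless_run; apply: lossless_cake.
by apply: lossless_bind => [|m3] //; apply: lossless_run; apply: lossless_cake.
Qed.

Definition hit (S0 : {set 'I_c}) (b : bool) : rat :=
  Ex (branch b) (fun x => ((x.1 == S0) && x.2)%:R).

(** Winning means guessing 1 when [b] is true and not guessing 1 when it is false; losslessness
    turns the latter into a complement. The guess is then split according to the chosen set. *)
Lemma cake_gameE :
  Pr (cake_game BC B c A) - 1 / 2%:R
    = (\sum_(S0 : {set 'I_c}) (hit S0 true - hit S0 false)) / 2%:R.
Proof.
have hits b : Ex (branch b) (fun x => x.2%:R) = \sum_S0 hit S0 b.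
  rewrite /hit -Ex_sum; apply: eq_Ex => -[S e] /=.
  rewrite (bigD1 S) //= eqxx big1 ?addr0 // => S0 SS0.
  by rewrite eq_sym (negbTE SS0).
have -> : Pr (cake_game BC B c A)
    = (Ex (branch true) (fun x => x.2%:R) + Ex (branch false) (fun x => (~~ x.2)%:R)) / 2%:R.
  rewrite PrE /cake_game /branch /= -[X in _ = X / _]mulrDl -big_split /=.
  rewrite [RHS]mulrAC [X in _ = X / _]mulr_suml; congr (_ * _); apply: eq_bigr => K _.
  rewrite Ex_bind [X in _ = (X + _) * _]Ex_bind [X in _ = (_ + X) * _]Ex_bind.
  rewrite -[X in _ = X * _]ExD -[RHS]Ex_mulr; apply: eq_Ex => m1.
  rewrite /= big_bool card_bool; congr ((_ / _ + _ / _) / _); apply: eq_bigr => C0 _.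
    rewrite [LHS]Ex_bind [RHS]Ex_bind; apply: eq_Ex => m2.
    by rewrite [LHS]Ex_bind [RHS]Ex_bind; apply: eq_Ex => m3 /=; case: (m3 0%N == 1).
  rewrite [LHS]Ex_bind [RHS]Ex_bind; apply: eq_Ex => m2.
  by rewrite [LHS]Ex_bind [RHS]Ex_bind; apply: eq_Ex => m3 /=; case: (m3 0%N == 1).
have notE : Ex (branch false) (fun x => (~~ x.2)%:R)
    = 1 - Ex (branch false) (fun x => x.2%:R).
  transitivity (Ex (branch false) (fun x => 1 - x.2%:R)).
    by apply: eq_Ex => -[S [|]] /=; rewrite ?subrr ?subr0.
  rewrite ExB; congr (_ - _); exact: lossless_branch.
rewrite [X in (_ + X) / _]notE [X in (X + _) / _]hits [X in (_ + (1 - X)) / _]hits.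
rewrite sumrB -mulrBl.
congr (_ * _).
by rewrite addrA addrAC addrK.
Qed.

(** If the chosen set is [S0], nothing is revealed and the guess cannot depend on the plaintext;
    otherwise the event is empty. *)
Lemma hit_hidden (S0 : {set 'I_c}) : #|S0| != (c - 2)%N -> hit S0 true = hit S0 false.
Proof.
move=> cS0; apply: eq_Ex_Draw => K.
rewrite [LHS]Ex_bind [RHS]Ex_bind; apply: eq_Ex => m1.
apply: eq_Ex_Draw => C0; rewrite [LHS]Ex_bind [RHS]Ex_bind; apply: eq_Ex => m2.
rewrite [LHS]Ex_bind [RHS]Ex_bind /=; have [eS|_] := eqVneq (chosen m2) S0; last first.
  transitivity (0 : rat); last apply/esym.
    by apply: lossless_run; apply: lossless_cake.
  by apply: lossless_run; apply: lossless_cake.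
by rewrite /reveal eS (negbTE cS0).
Qed.

Definition pad_prob (p : prog pad_oracle) (real : bool) : rat :=
  Ex (Draw (fun K : 'cV['F_2]_(keylen BC B) =>
        run (pad_oracles sel c2 (cipher K) real) p (start K)))
     (fun m => (m 0%N == 1)%:R).

Lemma lossless_pad (E : {perm block B}) real o m :
  lossless (pad_oracles sel c2 E real o m).
Proof.
case: o => //= r; case: (read_index c2 m 0) => [s|] //.
case: (read_index c2 m c2) => [t|] //; case: (s == t) => //; case: real.
  by apply: (lossless_Draw (0 : block B)).
by apply: (lossless_Draw [tuple of nseq (c2 - 2) (0 : block B)]).
Qed.

(** Since [real] is a fair bit, the advantage is half the gap between the real and the random
    world. *)
Lemma pad_gameE (p : prog pad_oracle) :
  Pr (pad_game BC sel B c2 p) - 1 / 2%:R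
    = (pad_prob p true - pad_prob p false) / 2%:R.
Proof.
have not_prob : 1 - pad_prob p false
    = Ex (Draw (fun K : 'cV['F_2]_(keylen BC B) =>
        run (pad_oracles sel c2 (cipher K) false) p (start K)))
      (fun m => (m 0%N != 1)%:R).
  symmetry.
  transitivity (Ex (Draw (fun K : 'cV['F_2]_(keylen BC B) =>
    run (pad_oracles sel c2 (cipher K) false) p (start K)))
    (fun m => 1 - (m 0%N == 1)%:R)).
    by apply: eq_Ex => m; case: (m 0%N == 1); rewrite ?subrr ?subr0.
  rewrite ExB; congr (_ - _).
  apply: (lossless_Draw 0) => K; apply: lossless_run; exact: lossless_pad.
have -> : Pr (pad_game BC sel B c2 p)
    = (pad_prob p true + (1 - pad_prob p false)) / 2%:R.
  rewrite not_prob PrE /pad_game /pad_prob /= -[X in _ = X / _]mulrDl -big_split /=.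
  rewrite [RHS]mulrAC [X in _ = X / _]mulr_suml; congr (_ * _); apply: eq_bigr => K _.
  rewrite big_bool card_bool [X in (X + _) / _]Ex_bind [X in (_ + X) / _]Ex_bind.
  congr ((_ + _) / _); apply: eq_Ex => m /=; by case: (m 0%N == 1).
rewrite -mulrBl; congr (_ * _).
by rewrite addrA addrAC addrK.
Qed.

(** For even [c] the holes are the two positions outside [S0]; for odd [c] they are the extra
    indices [c] and [c.+1] of the longer pad. *)
Lemma hole_indices (S0 : {set 'I_c}) : #|S0| = (c - 2)%N ->
  exists s t : 'I_c2, [/\ s != t, odd c -> (c <= s)%N /\ (c <= t)%N
    & forall j, j \in positions S0 -> [/\ (j < c)%N, j != s & j != t]].
Proof.
move=> cS0; have posE j : j \in positions S0 -> exists2 i, i \in S0 & j = val i.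
  by case/mapP => i; rewrite mem_filter => /andP[iS _] ->; exists i.
case: (boolP (odd c)) => codd.
  have c0 : (c < c2)%N by rewrite c2E codd; lia.
  have c1 : (c.+1 < c2)%N by rewrite c2E codd; lia.
  exists (Ordinal c0), (Ordinal c1); split=> [||j /posE[i _ ->]].
  - by rewrite -val_eqE /=; lia.
  - by move=> _; split=> //=; lia.
  by have := ltn_ord i; rewrite /=; split; lia.
have cc2 : (c <= c2)%N by rewrite c2E leq_addr.
have cS0C : #|~: S0| == 2%N.
  by have := cardsC S0; rewrite cS0 card_ord => cE; apply/eqP; lia.
have /cards2P[x [y [xy S0E]]] := cS0C.
exists (widen_ord cc2 x), (widen_ord cc2 y); split=> // j /posE[i iS ->].
have : i \notin ~: S0 by rewrite inE negbK.
rewrite S0E !inE negb_or => /andP[ix iy].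
by split; [exact: ltn_ord | exact: ix | exact: iy].
Qed.

Section FixedHole.
Variables (S0 : {set 'I_c}) (s t : 'I_c2).
Hypotheses (cS0 : #|S0| = (c - 2)%N) (st : s != t).
Hypotheses (us : @sel B c2 s t != s) (ut : @sel B c2 s t != t).
Hypothesis st_big : odd c -> (c <= s)%N /\ (c <= t)%N.
Hypothesis posP : forall j, j \in positions S0 -> [/\ (j < c)%N, j != s & j != t].
Local Notation u := (@sel B c2 s t).

(** By [view_padf], the sum of plaintext blocks in a revealed block is the view of the pad built on
    [plain_block P]. *)
Lemma reply_shift (w : seq (block B)) (P : c.-1.-tuple (block B)) :
  reply sel S0 s t w P
    = [seq view c s t u w j + view c s t u (padf s t u (plain_block P)) j
      | j <- positions S0].
Proof.
apply/eq_in_map => j /posP[jc js jt]; congr (_ + _).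
by rewrite (view_padf c_gt2 c2E st us ut st_big).
Qed.

Lemma reply_real (E : {perm block B}) (C0 : block B) (P : c.-1.-tuple (block B)) :
  reply sel S0 s t (pad E C0 s t u) P
    = [seq col j (ctr_ciphertext E C0 P *m bastion_mx c) | j <- enum 'I_c & j \in S0].
Proof.
rewrite /reply /positions -map_comp; apply/eq_in_map => j jS /=.
have [jc js jt] := posP (map_f val jS).
rewrite col_bastion big_split /=; congr (_ + _).
exact: (view_padf c_gt2 c2E st us ut st_big (ctr E C0)).
Qed.

(** By [reply_real], a real pad yields exactly the revealed blocks, so the attack reproduces the
    game without loss. *)
Lemma hit_real (b : bool) :
  hit S0 b = pad_prob (attack B sel A S0 s t b) true.
Proof.
apply: eq_Ex_Draw => K; rewrite Ex_attack // [LHS]Ex_bind; apply: eq_Ex => m1.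
set P := read_blocks _ _ _ _.
(* The draw of the initialization vector is moved past the choice stage. *)
transitivity (Ex (run (cans K) (adv_choose A) m1) (fun m2 =>
  Ex (bastion (cipher K) P) (fun C' =>
  Ex (run (cans K) (adv_guess A) (reveal C' (chosen m2) m2)) (fun m3 =>
  ((chosen m2 == S0) && (m3 0%N == 1))%:R)))).
  rewrite Ex_bind /= Ex_mulr Ex_sum; congr (_ * _); apply: eq_bigr => C0 _.
  rewrite [LHS]Ex_bind; apply: eq_Ex => m2.
  by rewrite [LHS]Ex_bind; apply: eq_Ex => m3.
apply: eq_Ex => m2; apply: eq_Ex_Draw => C0.
rewrite [LHS]/= [RHS]/=; have [eS|_] := eqVneq (chosen m2) S0; last first.
  transitivity (0 : rat); last apply/esym.
    by apply: lossless_run; apply: lossless_cake.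
  by apply: lossless_run; apply: lossless_cake.
by rewrite /reveal eS cS0 eqxx -reply_real.
Qed.

(** The plaintext only translates the uniform pad, and [sum_view_shift] removes the translation, so
    [b] has no influence. *)
Lemma hit_random :
  pad_prob (attack B sel A S0 s t true) false
    = pad_prob (attack B sel A S0 s t false) false.
Proof.
apply: eq_Ex_Draw => K; rewrite [LHS]Ex_attack // [RHS]Ex_attack //.
apply: eq_Ex => m1; apply: eq_Ex => m2.
set P1 := read_blocks _ _ _ _; set P0 := read_blocks _ _ _ _.
pose G (w : seq (block B)) := Ex (run (cans K) (adv_guess A) (store m2 0 (bits_of_blocks w)))
  (fun m3 => ((chosen m2 == S0) && (m3 0%N == 1))%:R).
have uniform P : Ex (pad_source (cipher K) false s t u) (fun w => G (reply sel S0 s t w P))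
    = (\sum_(R : (c2 - 2).-tuple (block B)) G [seq view c s t u R j | j <- positions S0])
      / #|{: (c2 - 2).-tuple (block B)}|%:R.
  rewrite /=; congr (_ * _).
  rewrite -(@sum_view_shift B c c2 s t u _ (padf s t u (plain_block P))).
    by apply: eq_bigr => R _; rewrite reply_shift.
  by rewrite (size_padf c_gt2 c2E st us ut).
by rewrite [LHS]uniform [RHS]uniform.
Qed.

End FixedHole.
End Hybrid.

(** * Negligibility *)

Definition coef_norm (n : nat) (p : {mpoly rat[n]}) : rat :=
  \sum_(m <- msupp p) `|p@_m|.

(** An arbitrary [p] need not be monotone, so it is replaced by a monotone bound: every monomial has
    degree below [msize p], and [x] is at least 1. *)
Lemma meval_le (n : nat) (p : {mpoly rat[n]}) (v : 'I_n -> rat) (x : rat) :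
  1 <= x -> (forall i, 0 <= v i <= x) ->
  p.@[v] <= coef_norm p * x ^+ msize p.
Proof.
move=> x1 vx; have x0 : 0 <= x by apply: le_trans x1.
apply: le_trans (ler_norm _) _; rewrite mevalE mulr_suml.
apply: le_trans (ler_norm_sum _ _ _) _.
rewrite big_seq [leRHS]big_seq; apply: ler_sum => m mp.
rewrite normrM ler_wpM2l // ger0_norm; last first.
  by apply: prodr_ge0 => i _; apply: exprn_ge0; have /andP[] := vx i.
apply: (@le_trans _ _ (x ^+ mdeg m)); last first.
  by apply: ler_weXn2l => //; apply: ltnW; apply: msize_mdeg_lt.
rewrite mdegE -prodrXr; apply: ler_prod => i _; have /andP[v0 vx'] := vx i.
by rewrite exprn_ge0 //= lerXn2r // nnegrE.
Qed.

(** Such a set is given by its complement of two elements, which leaves [c * c.-1 / 2] choices. *)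
Lemma card_draws_le (c : nat) : (2 <= c)%N ->
  (#|[set S : {set 'I_c} | #|S| == (c - 2)%N]| <= c ^ 2)%N.
Proof.
move=> c2; rewrite card_draws card_ord bin_sub // bin2.
have : (c * c.-1 <= c * c)%N by rewrite leq_mul2l leq_pred orbT.
by rewrite -mulnn; lia.
Qed.

(** The all-ones row times the matrix has all entries equal to the size minus one, hence zero in F_2
    for odd size: a nonzero kernel vector. *)
Lemma unitmx_bastion_even (c : nat) :
  (0 < c)%N -> bastion_mx c \in unitmx -> odd c = false.
Proof.
case: c => // c _ uM; apply: negbTE; apply/negP => codd.
have : const_mx 1 *m bastion_mx c.+1 = 0 :> 'rV['F_2]_c.+1.
  apply/rowP => j; rewrite !mxE (bigD1 j) //= !mxE eqxx mulr0 add0r.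
  rewrite (eq_bigr (fun=> 1)) => [|i ij]; last by rewrite !mxE ij mul1r.
  rewrite sumr_const (_ : #|_| = c); last first.
    have := cardC1 j; rewrite card_ord => cE; rewrite -[RHS]cE.
    by apply: eq_card => i; rewrite !inE.
  have ceven : odd c = false by move: codd => /= /negbTE.
  by rewrite -[c]odd_double_half ceven add0n -muln2 mulnC mulrnA mulr2n F2_addxx mul0rn.
move/(congr1 (fun v => v *m invmx (bastion_mx c.+1))).
by rewrite mulmxK // mul0mx => /rowP/(_ 0); rewrite !mxE.
Qed.

(** Common core of both halves of the theorem: [c2] is [c] for even [c] and [c + 2] for odd [c].
    Each set of positions costs two pad gaps, and only sets of size [c - 2] contribute. *)
Lemma cake_of_pad (BC : blockcipher) (sel : index_rule) (c c2 : nat -> nat) :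
  index_rule_ok sel -> block_count c ->
  (forall B, c2 B = (c B + (odd (c B)).*2)%N) ->
  pad_indistinguishable BC sel c2 -> cake_secure BC c.
Proof.
move=> sel_ok [c_gt2 [tc c_le]] c2E pad_ind t.
(* The bound of [size_attack], using that [c2 B + 1] is at most [tc.[B] + 3]. *)
pose T : {poly nat} := (t + 1) * ((20%N)%:P * ('X + 1) * (tc + (3%N)%:P) ^+ 2).
have [p p_adv] := pad_ind T.
pose D := msize p.
(* The factor 2 is half of 4: two gaps of at most [2 * eps] per set, halved by [cake_gameE]. The
   square bounds the number of sets, and the last factor evaluates to [x ^+ D]. *)
pose q : {mpoly rat[3]} := (2%:R * coef_norm p)%:MP_[3] * 'X_1 ^+ 2
  * ('X_0 + ('X_1 + 2%:R) + ('X_2 * 'X_1 + 1)) ^+ D.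
exists q => B A sizeA.
have c2_gt2 : (2 < c2 B)%N by rewrite c2E; apply: leq_trans (c_gt2 B) (leq_addr _ _).
pose M := cake_queries A.
(* A single number that is at least 1 and dominates the three arguments of [p]: [B], [c2 B] and the
   query count of the attack. *)
pose x : rat := (B + (c B + 2) + (M * c B + 1))%:R.
pose eps := coef_norm p * x ^+ D / 2%:R ^+ B.
have eps_ge0 : 0 <= eps.
  by rewrite !mulr_ge0 ?invr_ge0 ?exprn_ge0 ?ler0n ?sumr_ge0.
have attack_gap (S0 : {set 'I_(c B)}) (s s' : 'I_(c2 B)) b : let p' := attack B sel A S0 s s' b in
    `|pad_prob BC B (c2 B) sel p' true - pad_prob BC B (c2 B) sel p' false| <= 2%:R * eps.
  move=> p'; have p'_size : (size p' <= T.[B])%N.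
    have c_gt0 : (0 < c B)%N by apply: ltn_trans (c_gt2 B).
    have c_c2 : (c B <= c2 B)%N by rewrite c2E leq_addr.
    have p'_le := @size_attack B (c B) (c2 B) sel A S0 s s' b c_gt0 c_c2.
    apply: (leq_trans p'_le).
    have -> : T.[B] = ((t.[B] + 1) * (20 * (B + 1) * (tc.[B] + 3) ^ 2))%N.
      by rewrite /T !(hornerM, hornerD, horner_exp, hornerC, hornerX).
    have := c_le B; rewrite c2E => cB_le.
    apply: leq_mul; first by rewrite addn1 ltnS.
    apply: leq_mul; first by rewrite addn1.
    by rewrite leq_exp2r //; case: odd; lia.
  have := p_adv B p' p'_size; rewrite /advantage_le pad_gameE normrM.
  rewrite [X in _ * X]ger0_norm ?invr_ge0 ?ler0n // ler_pdivrMr ?ltr0n //.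
  move=> /le_trans; apply; rewrite mulrC ler_pM2l ?ltr0n //.
  rewrite ler_wpM2r ?invr_ge0 ?exprn_ge0 ?ler0n //; apply: meval_le.
    by rewrite ler1n addn1 addnS.
  have c2_le : (c2 B <= c B + 2)%N by rewrite c2E leq_add2l; case: odd.
  have q_le : (queries p' <= M * c B + 1)%N.
    by apply: queries_attack; apply: ltn_trans (c_gt2 B).
  by move=> -[[|[|[|]]] //= i3]; rewrite ler0n ler_nat; lia.
have hit_gap (S0 : {set 'I_(c B)}) : `|hit BC B A S0 true - hit BC B A S0 false|
    <= if #|S0| == (c B - 2)%N then 4%:R * eps else 0.
  case: eqP => [cS0|/eqP cS0]; last by rewrite hit_hidden // subrr normr0.
  have [s [s' [ss' st_big posP]]] := hole_indices (c_gt2 B) (c2E B) cS0.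
  have [us us'] := sel_ok B (c2 B) s s' c2_gt2 ss'.
  have hitE := hit_real BC A (c_gt2 B) (c2E B) cS0 ss' us us' st_big posP.
  have randE := hit_random BC A (c_gt2 B) (c2E B) cS0 ss' us us' st_big posP.
  have := attack_gap S0 s s' true; have := attack_gap S0 s s' false.
  rewrite /= hitE hitE randE => gap0 gap1.
  (* The difference telescopes through the random worlds of the two attacks, which coincide by
     [randE]. *)
  rewrite -(subrKA (pad_prob BC B (c2 B) sel (attack B sel A S0 s s' false) false)).
  apply: le_trans (ler_normD _ _) _; rewrite (_ : 4%:R * eps = 2%:R * eps + 2%:R * eps).
    by rewrite lerD // distrC.
  by rewrite -mulrDl.
rewrite /advantage_le cake_gameE normrM [X in _ * X]ger0_norm ?invr_ge0 ?ler0n //.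
rewrite ler_pdivrMr ?ltr0n //.
apply: le_trans (ler_norm_sum _ _ _) _.
apply: (@le_trans _ _ (\sum_(S0 : {set 'I_(c B)})
    if #|S0| == (c B - 2)%N then 4%:R * eps else 0)); first exact: ler_sum.
rewrite -big_mkcond sumr_const -[_ *+ _]mulr_natr.
apply: (@le_trans _ _ (4%:R * eps * ((c B)%:R ^+ 2))).
  rewrite ler_wpM2l ?(mulr_ge0 (ler0n _ _) eps_ge0) // -natrX ler_nat.
  have := card_draws_le (ltnW (c_gt2 B)); congr (_ <= _)%N.
  by apply: eq_card => S; rewrite !inE.
rewrite /q !(rmorphM, rmorphD, rmorphXn, rmorph1, rmorph_nat) /= mevalC !mevalXU /=.
have <- : x = B%:R + ((c B)%:R + 2%:R) + (M%:R * (c B)%:R + 1).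
  by rewrite /x natrD natrD natrD natrD natrM.
rewrite /eps le_eqVlt; apply/orP; left; apply/eqP.
by move: (coef_norm p) (x ^+ D) (2%:R ^- B) => n y z; ring.
Qed.

Theorem proposition2 (BC : blockcipher) (sel : index_rule)
    (sel_ok : index_rule_ok sel) :
  (forall c : nat -> nat, block_count c ->
     (forall B, bastion_mx (c B) \in unitmx) ->
     pad_indistinguishable BC sel c -> cake_secure BC c)
  /\
  ((forall c : nat -> nat, block_count c -> pad_indistinguishable BC sel c) ->
   forall c : nat -> nat, block_count c -> cake_secure BC c).
Proof.
split=> [c cc c_unit|pad_ind c cc].
  (* Invertibility forces [c B] to be even, so [c2] can be [c] itself. *)
  apply: (cake_of_pad sel_ok cc) => B.
  by rewrite (unitmx_bastion_even _ (c_unit B)) ?addn0 //; apply: ltn_trans (cc.1 B).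
(* For odd [c B] the hypothesis is used at [c B + 2], which still gives a polynomially bounded block
   count. *)
apply: (cake_of_pad sel_ok cc (fun=> erefl)); apply: pad_ind.
case: cc => c_gt2 [t c_le]; split=> [B|].
  exact: leq_trans (c_gt2 B) (leq_addr _ _).
exists (t + (2%N)%:P) => B; rewrite hornerD hornerC.
by apply: leq_add => //; case: odd.
Qed.
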